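(* Let $\nu$ be a rank one valuation on $K[x]$ with characteristic exponent $p$, and let $\alpha\in\mathbb{N}$ be such that the set $\Psi_\alpha$ of key polynomials for $\nu$ of degree $\alpha$ is non-empty and for every $Q\in\Psi_\alpha$ there exists $Q'\in\Psi_\alpha$ with $\epsilon(Q)<\epsilon(Q')$. Assume that $\Psi_\alpha$ admits a limit key polynomial. Then there exist $r\in\mathbb{N}$, $Q\in\Psi_\alpha$ and a limit key polynomial $F$ for $\Psi_\alpha$ such that the $Q$-expansion of $F$ is of the form \[ F=Q^{p^r}+a_{p^{r-1}}Q^{p^{r-1}}+\ldots+a_1Q+a_0, \] i.e. apart from the term $a_0$, only terms $a_iQ^i$ with $i$ a power of $p$ occur.
   Context: $K$ is a field. A valuation on a commutative ring $R$ with unity is a map $\nu:R\to\Gamma\cup\{\infty\}$, where $\Gamma$ is an ordered abelian group (addition and order being extended to $\infty$ in the obvious way), such that $\nu(fg)=\nu(f)+\nu(g)$ and $\nu(f+g)\ge\min\{\nu(f),\nu(g)\}$ for all $f,g\in R$, $\nu(1)=0$ and $\nu(0)=\infty$. Here $\nu$ is a valuation on $K[x]$ of rank one (its value group is order-isomorphic to a nontrivial subgroup of $\mathbb{R}$). The characteristic exponent $p$ is the characteristic of the residue field $K\nu$ of $\nu$ on $K$ if this is positive, and $p=1$ if it is $0$. $\partial_b f$ is the Hasse derivative of $f$ of order $b$ (so $f(x+y)=\sum_{b\ge0}\partial_bf(x)\,y^b$). The level of $f\in K[x]\setminus\{0\}$ is $\epsilon(f)=\max_{b\in\mathbb{N}}\left\{\frac{\nu(f)-\nu(\partial_bf)}{b}\right\}$.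 A monic polynomial $Q\in K[x]\setminus K$ is a key polynomial for $\nu$ if $\epsilon(f)<\epsilon(Q)$ for every $f\in K[x]\setminus\{0\}$ with $\deg(f)<\deg(Q)$. For $f,q\in K[x]$ with $\deg(q)\ge1$, the $q$-expansion of $f$ is the unique expression $f=f_nq^n+\ldots+f_1q+f_0$ with each $f_i=0$ or $\deg(f_i)<\deg(q)$; the truncation of $\nu$ on $q$ is $\nu_q(f)=\min_{0\le i\le n}\nu(f_iq^i)$. $S_\alpha=\{f\in K[x]\mid \nu_Q(f)<\nu(f)\text{ for every }Q\in\Psi_\alpha\}$. A limit key polynomial for $\Psi_\alpha$ (under the assumption that for every $Q\in\Psi_\alpha$ there is $Q'\in\Psi_\alpha$ with $\epsilon(Q)<\epsilon(Q')$) is a monic polynomial $F\in K[x]$ which belongs to $S_\alpha$ and has the least degree among polynomials in $S_\alpha$.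
   Formalization: The valuation ν is assumed to have trivial support (ν(f)=∞ only for f=0); otherwise the level ε(f) is undefined for some nonzero f and the claim fails, e.g. for ν(f)=v_5(f(i)) on Q[x] with i²=−1 in Q_5, where limit key polynomials for Ψ_1 have degree 2. *)

(* Defs.v *)
From HB Require Import structures.
From mathcomp Require Import all_boot all_order all_algebra.
From mathcomp Require Import generic_quotient ring_quotient.
From mathcomp Require Import all_classical all_reals.

Set Implicit Arguments.
Unset Strict Implicit.
Unset Printing Implicit Defensive.

Import Order.TTheory GRing.Theory Num.Theory.
Local Open Scope ring_scope.
Local Open Scope ereal_scope.

(* The value group is embedded in R, so that values live in R together with
   +oo; -oo is a point of \bar R but never a value. *)
Record valuation (A : comNzRingType) (R : realType) := Valuation {
  valuation_fun :> A -> \bar R;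
  valuation_neqNy : forall f, valuation_fun f != -oo;
  valuationM : forall f g, valuation_fun (f * g)%R = valuation_fun f + valuation_fun g;
  valuation_min : forall f g, mine (valuation_fun f) (valuation_fun g) <= valuation_fun (f + g)%R;
  valuation1 : valuation_fun 1%R = 0;
  valuation0 : valuation_fun 0%R = +oo
}.

Lemma valuationN1 (A : comNzRingType) (R : realType) (v : valuation A R) :
  v (- 1)%R = 0.
Proof.
have := valuationM v (- 1)%R (- 1)%R; rewrite mulrNN mulr1 valuation1.
have := valuation_neqNy v (- 1)%R.
case: (v (- 1)%R) => [x| |] //= _ [] /esym/eqP.
by rewrite -mulr2n mulrn_eq0 /= => /eqP ->.
Qed.

Lemma valuationN (A : comNzRingType) (R : realType) (v : valuation A R) (f : A) :
  v (- f)%R = v f.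
Proof. by rewrite -mulN1r valuationM valuationN1 add0e. Qed.

Lemma valuationV (K : fieldType) (R : realType) (v : valuation K R) (a : K) :
  a != 0%R -> v a^-1%R = - v a.
Proof.
move=> a0; have := valuationM v a a^-1%R; rewrite mulfV// valuation1.
have := valuation_neqNy v a; have := valuation_neqNy v a^-1%R.
case: (v a) => [x| |] //; case: (v a^-1%R) => [y| |] // _ _ [] /esym/eqP.
by rewrite addrC addr_eq0 => /eqP ->.
Qed.

Section ResidueField.
Variables (K : fieldType) (R : realType) (v : valuation K R).

Definition val_ring : {pred K} := [pred a | 0 <= v a].

Lemma val_ring_subring : subring_closed val_ring.
Proof.
split=> [|a b|a b]; rewrite ?inE /= ?valuation1// => va vb.
- by apply: le_trans (valuation_min v _ _); rewrite valuationN le_min va vb.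
- by rewrite valuationM adde_ge0.
Qed.
HB.instance Definition _ :=
  GRing.isSubringClosed.Build K val_ring val_ring_subring.

Record val_int := ValInt { int_val :> K; _ : int_val \in val_ring }.
HB.instance Definition _ := [isSub for int_val].
HB.instance Definition _ := [Choice of val_int by <:].
HB.instance Definition _ := [SubChoice_isSubComNzRing of val_int by <:].

Definition val_max_ideal : {pred val_int} := [pred a | 0 < v (int_val a)].

Lemma val_max_ideal_closed : idealr_closed val_max_ideal.
Proof.
split=> [||a x y]; rewrite !inE /= ?valuation0 ?valuation1 ?ltxx ?lt0y// => vx vy.
apply: lt_le_trans (valuation_min v _ _); rewrite lt_min vy andbT valuationM.
have : 0 <= v (int_val a) by case: a.
by move=> va; rewrite (lt_le_trans vx)// leeDr.
Qed.
HB.instance Definition _ :=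
  isIdealr.Build val_int val_max_ideal val_max_ideal_closed.

Definition residue := {ideal_quot val_max_ideal}.
HB.instance Definition _ := GRing.ComNzRing.on residue.

Local Open Scope quotient_scope.

Lemma residue_eq0 (a : val_int) :
  (\pi_residue a == 0%R) = (0 < v (int_val a)).
Proof.
have -> : 0%R = \pi_residue 0%R by rewrite (rmorph0 (\pi_residue)).
by rewrite -Quotient.idealrBE subr0.
Qed.

Definition residue_inv (x : residue) : residue :=
  if x == 0%R then 0%R
  else \pi_residue (insubd (0%R : val_int) (int_val (repr x))^-1%R).

Lemma residue_mulVx (x : residue) : x != 0%R -> (residue_inv x * x)%R = 1%R.
Proof.
move=> x0; rewrite /residue_inv (negPf x0).
have: ~~ (0 < v (int_val (repr x))) by rewrite -residue_eq0 reprK.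
rewrite -leNgt => vx.
have vx0 : v (int_val (repr x)) = 0.
  by apply/eqP; rewrite eq_le vx; case: (repr x).
have rx0 : int_val (repr x) != 0%R.
  by apply: contra_eq_neq vx0 => ->; rewrite valuation0.
rewrite -[X in (_ * X)%R]reprK -rmorphM -[RHS](rmorph1 (\pi_residue)).
congr \pi_residue; apply: val_inj => /=.
by rewrite insubdK ?mulVf// inE /= valuationV// vx0 oppe0.
Qed.

Lemma residue_inv0 : residue_inv 0%R = 0%R.
Proof. by rewrite /residue_inv eqxx. Qed.

HB.instance Definition _ :=
  GRing.ComNzRing_isField.Build residue residue_mulVx residue_inv0.

End ResidueField.

Section Levels.
Variables (K : fieldType) (R : realType) (nu : valuation {poly K} R).
Implicit Types f g q Q F : {poly K}.

Definition rank_one := exists f, nu f \is a fin_num /\ nu f != 0.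

(* Needed for the level of every nonzero f to be defined: otherwise nu f and
   nu f^`N(b) may both be infinite.  With a nontrivial support, limit key
   polynomials need not have degree a power of p times alpha: take K = Q and
   nu f = v_5(f(i)) with i a square root of -1 in Q_5; then 'X^2 + 1 is a limit
   key polynomial for Psi 1. *)
Definition trivial_support := forall f, nu f = +oo -> f = 0%R.

Definition val_const : valuation K R.
Proof.
refine (@Valuation K R (fun a => nu a%:P) _ _ _ _ _).
- by move=> a; apply: valuation_neqNy.
- by move=> a b; rewrite polyCM valuationM.
- by move=> a b; rewrite polyCD valuation_min.
- by rewrite polyC1 valuation1.
- by rewrite polyC0 valuation0.
Defined.

Definition char_exponent (p : nat) : Prop :=
  p \in [pchar residue val_const] \/
  p = 1%N /\ [pchar residue val_const] =i pred0.

(* f^`N(b) is the Hasse derivative of order b.  The terms with b >= size f are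
   left out of the maximum: there f^`N(b) = 0 and the term is -oo, as checked by
   level_ub. *)
Definition level f : \bar R :=
  \big[maxe/-oo]_(1 <= b < size f) ((nu f - nu f^`N(b)) * (b%:R^-1)%:E).

Lemma level_ub f b : (0 < b)%N ->
  (nu f - nu f^`N(b)) * (b%:R^-1)%:E <= level f.
Proof.
move=> b0; case: (ltnP b (size f)) => [bf|fb].
  by rewrite /level (bigD1_seq b) ?mem_index_iota ?b0 ?iota_uniq//= le_max lexx.
rewrite nderivn_poly0// valuation0 /= addeNy mulNyr gtr0_sg ?mul1e ?leNye//.
by rewrite invr_gt0 ltr0n.
Qed.

Definition key_poly Q :=
  [/\ Q \is monic, (1 < size Q)%N &
      forall f, f != 0%R -> (size f < size Q)%N -> level f < level Q].

Definition Psi (alpha : nat) : set {poly K} :=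
  [set Q | key_poly Q /\ (size Q).-1 = alpha].

(* The coefficient of q ^+ i in the q-expansion of f, obtained by successive
   Euclidean divisions by q; see qcoef_sum and qcoef_uniq. *)
Definition qcoef q f (i : nat) : {poly K} := ((f %/ q ^+ i) %% q)%R.

Lemma size_qcoef q f i : (1 < size q)%N -> (size (qcoef q f i) < size q)%N.
Proof. by move=> q1; rewrite ltn_modp -size_poly_gt0 (ltn_trans _ q1). Qed.

Lemma qcoef0 q f : qcoef q f 0 = (f %% q)%R.
Proof. by rewrite /qcoef expr0 divp1. Qed.

Lemma qcoefS q f i : qcoef q f i.+1 = qcoef q (f %/ q)%R i.
Proof. by rewrite /qcoef exprS divp_divl. Qed.

Lemma qcoef_sum q f n : (1 < size q)%N -> (size f <= n)%N ->
  f = (\sum_(i < n) qcoef q f i * q ^+ i)%R.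
Proof.
move=> q1; elim: n f => [|n IHn] f.
  by rewrite leqn0 size_poly_eq0 big_ord0 => /eqP.
move=> fn; rewrite big_ord_recl qcoef0 expr0 mulr1 addrC.
have q0 : q != 0%R by rewrite -size_poly_gt0 (ltn_trans _ q1).
rewrite {1}(divp_eq f q); congr (_ + _)%R.
rewrite {1}(IHn (f %/ q)%R); last first.
  rewrite size_divp// leq_subLR (leq_trans fn)// -add1n leq_add2r.
  by rewrite -ltnS prednK// (ltn_trans _ q1).
rewrite mulr_suml; apply: eq_bigr => i _.
by rewrite -mulrA -exprSr lift0 qcoefS.
Qed.

Lemma qcoef_uniq q n (c : nat -> {poly K}) i : (1 < size q)%N ->
  (forall j, (size (c j) < size q)%N) ->
  qcoef q (\sum_(j < n) c j * q ^+ j)%R i = if (i < n)%N then c i else 0%R.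
Proof.
move=> q1; have q0 : q != 0%R by rewrite -size_poly_gt0 (ltn_trans _ q1).
elim: n c i => [|n IHn] c i cq.
  by rewrite big_ord0 /qcoef div0p mod0p.
have -> : (\sum_(j < n.+1) c j * q ^+ j =
    (\sum_(j < n) c j.+1 * q ^+ j) * q + c 0%N)%R.
  rewrite big_ord_recl expr0 mulr1 addrC; congr (_ + _)%R.
  rewrite mulr_suml; apply: eq_bigr => j _.
  by rewrite -mulrA -exprSr lift0.
case: i => [|i]; first by rewrite qcoef0 modp_addl_mul_small.
by rewrite qcoefS divp_addl_mul_small// (IHn (fun j => c j.+1)).
Qed.

Definition truncation q f : \bar R :=
  \big[mine/+oo]_(i < size f) nu (qcoef q f i * q ^+ i)%R.

Definition S_ (alpha : nat) : set {poly K} :=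
  [set f | forall Q, Psi alpha Q -> truncation Q f < nu f].

Definition limit_key_poly (alpha : nat) F :=
  [/\ F \is monic, S_ alpha F &
      forall g, S_ alpha g -> (size F <= size g)%N].

End Levels.

(* F = Q ^+ (p ^ r) + a_{p^(r-1)} Q ^+ (p ^ r.-1) + ... + a_1 Q + a_0, stated
   coefficientwise so that it also makes sense for p = 1, where the powers
   p ^ s coincide and the form is Q + a_0. *)
Definition p_expansion (K : fieldType) (p r : nat) (Q F : {poly K}) :=
  [/\ qcoef Q F (p ^ r) = 1%R,
      forall i, (p ^ r < i)%N -> qcoef Q F i = 0%R &
      forall i, (0 < i < p ^ r)%N -> qcoef Q F i != 0%R ->
        exists2 s, (s < r)%N & i = (p ^ s)%N].

(* Main.v *)
(* Let N be the set of polynomials of degree less than alpha.  For Q in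
   Psi_alpha and a, b in N, the carry in the Q-expansion of a b has value larger
   than nu (a b); as there is no maximal level, the excess is at least a fixed
   g > 0 for all Q in a cofinal part of Psi_alpha.

   Let F be a limit key polynomial and B the supremum of the values nu_Q F.
   Removing from F a polynomial H with nu_Q H > B keeps it in S_alpha.  Choose
   Q0 with nu_Q0 F > B - g, and read the Q0-expansion of F as a polynomial L in
   K[x][X], so that F = L(Q0).  Re-expanding F in powers of Q, by Taylor at
   Q0 - Q, the carries have value larger than B, so that the coefficients may be
   replaced by the remainders modulo Q of the Hasse derivatives
   f_i = (d_i L)(Q0).  For i > 0, f_i has degree less than F, hence the value of
   this remainder is eventually nu f_i.

   If i is not a power of p, let m be the largest power of p dividing i.  Then
   'C(i, m) is a unit of the residue field, and the Taylor expansion of f_m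
   shows that nu f_i + i nu Q exceeds nu f_m + m nu Q by an increasing amount,
   hence exceeds B eventually, and the i-th term can be removed.  By minimality
   of the degree of F, the leading term survives and its coefficient is 1. *)
Require Import Defs.
From mathcomp Require Import all_boot all_order all_algebra.
From mathcomp Require Import generic_quotient ring_quotient.
From mathcomp Require Import all_classical all_reals.
From mathcomp Require Import ring lra.

Set Implicit Arguments.
Unset Strict Implicit.
Unset Printing Implicit Defensive.

Import Order.TTheory GRing.Theory Num.Theory.
Local Open Scope ring_scope.

(** * Iterated Hasse derivatives and sizes of polynomials *)

Lemma nderivn_nderivn (A : nzRingType) (q : {poly A}) (m j : nat) :
  q^`N(m)^`N(j) = q^`N(m + j) *+ 'C(m + j, m).
Proof.
apply/polyP => i; rewrite coefMn !coef_nderivn -addnA -!mulrnA; congr (_ *+ _).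
have mj : (m`! * j`! * i`! > 0)%N by rewrite !muln_gt0 !fact_gt0.
apply/eqP; rewrite -(eqn_pmul2r mj); apply/eqP.
have fact_bin a b : ('C(a + b, a) * (a`! * b`!))%N = (a + b)`!.
  by rewrite -(bin_fact (leq_addr b a)) addKn.
transitivity (m + (j + i))`!.
  by rewrite -(fact_bin m (j + i)%N) -(fact_bin j i); ring.
by rewrite addnA -(fact_bin (m + j)%N i) -(fact_bin m j); ring.
Qed.

Lemma size_polyMn_leq (A : nzSemiRingType) (q : {poly A}) (m : nat) :
  (size (q *+ m)%R <= size q)%N.
Proof. by rewrite -scaler_nat size_scale_leq. Qed.

Lemma modpMn (K : fieldType) (q f : {poly K}) (m : nat) :
  (f *+ m) %% q = (f %% q) *+ m.
Proof. by rewrite -!scaler_nat modpZl. Qed.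

Lemma size_sub_monic (A : nzRingType) (f h : {poly A}) (n : nat) :
  f \is monic -> h \is monic -> size f = n.+1 -> size h = n.+1 ->
  (size (f - h)%R <= n)%N.
Proof.
move=> /eqP lf /eqP lh sf sh; rewrite !lead_coefE sf sh /= in lf lh.
apply/leq_sizeP => j nj; rewrite coefB; case: (ltngtP n j) nj => // [nj|<-] _.
  by rewrite !nth_default ?sf ?sh ?subr0.
by rewrite lf lh subrr.
Qed.

(** * Values as real numbers and lower bounds for values *)

Section FiniteValues.
Variables (K : fieldType) (R : realType) (nu : valuation {poly K} R).
Implicit Types (f g h : {poly K}) (c d : R) (n : nat).

(** [fine] sends [+oo] to 0, so [rval] is meaningful on nonzero polynomials only; [vge] also covers
    the zero polynomial, for which every lower bound holds. *)
Definition rval f : R := fine (nu f).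
Definition vge f c := (c%:E <= nu f)%E.

Lemma vge0 c : vge 0 c.
Proof. by rewrite /vge valuation0 leey. Qed.

Lemma vgeW f c d : c <= d -> vge f d -> vge f c.
Proof. by move=> cd; apply: le_trans; rewrite lee_fin. Qed.

Lemma vgeD f g c : vge f c -> vge g c -> vge (f + g) c.
Proof.
move=> fc gc; apply: le_trans (valuation_min nu f g).
by rewrite le_min; apply/andP.
Qed.

Lemma vgeN f c : vge f c -> vge (- f) c.
Proof. by rewrite /vge valuationN. Qed.

Lemma vgeB f g c : vge f c -> vge g c -> vge (f - g) c.
Proof. by move=> fc gc; apply: vgeD => //; apply: vgeN. Qed.

Lemma vgeM f g c d : vge f c -> vge g d -> vge (f * g) (c + d).
Proof. by move=> fc gd; rewrite /vge valuationM EFinD leeD. Qed.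

Lemma vge1 : vge 1 0.
Proof. by rewrite /vge valuation1. Qed.

Lemma vgeX f n c : vge f c -> vge (f ^+ n) (n%:R * c).
Proof.
move=> fc; elim: n => [|n IHn]; first by rewrite mul0r expr0; apply: vge1.
by rewrite exprS mulrS mulrDl mul1r; apply: vgeM.
Qed.

Lemma vge_sum (I : Type) (r : seq I) (P : pred I) (G : I -> {poly K}) c :
  (forall i, P i -> vge (G i) c) -> vge (\sum_(i <- r | P i) G i) c.
Proof.
move=> Gc; elim/big_rec: _ => [|i g Pi gc]; first exact: vge0.
by apply: vgeD => //; apply: Gc.
Qed.

Hypothesis nu_supp : trivial_support nu.

Lemma rvalE f : f != 0 -> nu f = (rval f)%:E.
Proof.
move=> f0; have := valuation_neqNy nu f; have := nu_supp (f := f).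
rewrite /rval; case: (nu f) => [x| |] //= H _.
by rewrite (H erefl) eqxx in f0.
Qed.

Lemma vgeE f c : f != 0 -> vge f c = (c <= rval f).
Proof. by move=> f0; rewrite /vge rvalE ?lee_fin. Qed.

Lemma vge_rval f : f != 0 -> vge f (rval f).
Proof. by move=> f0; rewrite vgeE. Qed.

Lemma rvalM f g : f != 0 -> g != 0 -> rval (f * g) = rval f + rval g.
Proof. by move=> f0 g0; rewrite /rval valuationM fineD ?rvalE. Qed.

Lemma rval1 : rval 1 = 0.
Proof. by rewrite /rval valuation1. Qed.

Lemma rvalX f n : f != 0 -> rval (f ^+ n) = n%:R * rval f.
Proof.
move=> f0; elim: n => [|n IHn]; first by rewrite mul0r expr0 rval1.
by rewrite exprS rvalM ?expf_neq0// IHn mulrS mulrDl mul1r.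
Qed.

Lemma vge_mulr f g c : g != 0 -> vge (f * g) c -> vge f (c - rval g).
Proof.
move=> g0; have [->|f0] := eqVneq f 0; first by move=> _; apply: vge0.
by rewrite !vgeE ?mulf_neq0// rvalM// lerBlDr.
Qed.

(** Strict dominance: a perturbation of value larger than [rval f] can neither cancel [f] nor change
    its value. *)
Lemma rval_dom f g c : f != 0 -> rval f < c -> vge (g - f) c ->
  g != 0 /\ rval g = rval f.
Proof.
move=> f0 fc gfc; have g0 : g != 0.
  apply/eqP => g0; move: gfc; rewrite g0 sub0r => /vgeN.
  by rewrite opprK vgeE// leNgt fc.
split=> //; apply/eqP; rewrite eq_le; apply/andP; split; last first.
  rewrite -vgeE// -(subrK f g); apply: vgeD; last exact: vge_rval.
  exact: vgeW (ltW fc) _.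
rewrite leNgt; apply/negP => fg.
have : vge f (Num.min (rval g) c).
  rewrite -[f](subKr g); apply: vgeB; first by rewrite vgeE// ge_min lexx.
  by apply: vgeW gfc; rewrite ge_min lexx orbT.
by rewrite vgeE// leNgt lt_min fg fc.
Qed.

End FiniteValues.

(** * Coefficients of q-expansions and lower bounds for truncations *)

Section QCoef.
Variable K : fieldType.
Implicit Types f g q : {poly K}.

Lemma qcoefD q f g i : qcoef q (f + g) i = qcoef q f i + qcoef q g i.
Proof. by rewrite /qcoef divpD modpD. Qed.

Lemma qcoefN q f i : qcoef q (- f) i = - qcoef q f i.
Proof. by rewrite /qcoef divpN modpN. Qed.

Lemma qcoef_0 q i : qcoef q 0 i = 0.
Proof. by rewrite /qcoef div0p mod0p. Qed.

Lemma qcoef_mulr q f i : (1 < size q)%N ->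
  qcoef q (f * q) i = if i is j.+1 then qcoef q f j else 0.
Proof.
move=> q1; have q0 : q != 0 by rewrite -size_poly_gt0 ltnW.
by case: i => [|i]; rewrite ?qcoef0 ?modp_mull // qcoefS mulpK.
Qed.

Lemma qcoef_small q f i : (size f < size q)%N ->
  qcoef q f i = if i is 0 then f else 0.
Proof.
move=> fq; case: i => [|i]; first by rewrite qcoef0 modp_small.
by rewrite qcoefS divp_small// qcoef_0.
Qed.

Lemma qcoef_ge q f i : (1 < size q)%N -> (size f <= i)%N -> qcoef q f i = 0.
Proof.
move=> q1 fi; rewrite (qcoef_sum q1 fi) qcoef_uniq ?ltnn// => j.
exact: size_qcoef.
Qed.

End QCoef.

Section Truncation.
Variables (K : fieldType) (R : realType) (nu : valuation {poly K} R).
Hypothesis nu_supp : trivial_support nu.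
Implicit Types (a b f h q Q : {poly K}) (c d : R) (n : nat).
Local Notation vge := (vge nu).
Local Notation rval := (rval nu).

(** This encodes that [c] is at most the truncation of [f] on [Q]; coefficients beyond the degree
    vanish, so [i] needs no bound. *)
Definition tge Q f c := forall i, vge (qcoef Q f i * Q ^+ i) c.

Lemma tge0 Q c : tge Q 0 c.
Proof. by move=> i; rewrite qcoef_0 mul0r; apply: vge0. Qed.

Lemma tgeW Q f c d : c <= d -> tge Q f d -> tge Q f c.
Proof. by move=> cd fd i; apply: vgeW cd (fd i). Qed.

Lemma tgeD Q f h c : tge Q f c -> tge Q h c -> tge Q (f + h) c.
Proof. by move=> fc hc i; rewrite qcoefD mulrDl; apply: vgeD. Qed.

Lemma tgeN Q f c : tge Q f c -> tge Q (- f) c.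
Proof. by move=> fc i; rewrite qcoefN mulNr; apply: vgeN. Qed.

Lemma tgeB Q f h c : tge Q f c -> tge Q h c -> tge Q (f - h) c.
Proof. by move=> fc hc; apply: tgeD => //; apply: tgeN. Qed.

Lemma tgeMn Q f n c : tge Q f c -> tge Q (f *+ n) c.
Proof.
move=> fc; elim: n => [|n IHn]; first by rewrite mulr0n; apply: tge0.
by rewrite mulrS; apply: tgeD.
Qed.

Lemma tge_sum Q (I : Type) (r : seq I) (P : pred I) (G : I -> {poly K}) c :
  (forall i, P i -> tge Q (G i) c) -> tge Q (\sum_(i <- r | P i) G i) c.
Proof.
move=> Gc; elim/big_rec: _ => [|i g Pi gc]; first exact: tge0.
by apply: tgeD => //; apply: Gc.
Qed.

Lemma tge_small Q f c : (size f < size Q)%N -> vge f c -> tge Q f c.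
Proof.
move=> fQ fc [|i]; rewrite qcoef_small ?expr0 ?mulr1 ?mul0r//.
exact: vge0.
Qed.

Lemma tge_modp Q f c : (1 < size Q)%N -> tge Q f c -> vge (f %% Q) c.
Proof. by move=> Q1 /(_ 0%N); rewrite qcoef0 expr0 mulr1. Qed.

Lemma tge_modp_small Q f c : (1 < size Q)%N -> tge Q f c -> tge Q (f %% Q) c.
Proof.
move=> Q1 fc; apply: tge_small; last exact: tge_modp.
by rewrite ltn_modp -size_poly_gt0 ltnW.
Qed.

Lemma tge_vge Q f c : (1 < size Q)%N -> tge Q f c -> vge f c.
Proof.
by move=> Q1 fc; rewrite (qcoef_sum Q1 (leqnn (size f))); apply: vge_sum => i _.
Qed.

Lemma tge_mulQ Q f c d : (1 < size Q)%N -> vge Q d ->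
  tge Q f c -> tge Q (f * Q) (c + d).
Proof.
move=> Q1 Qd fc i; rewrite qcoef_mulr//; case: i => [|i].
  by rewrite mul0r; apply: vge0.
by rewrite exprSr mulrA; apply: vgeM.
Qed.

Lemma tge_mulXQ Q f i c d : (1 < size Q)%N -> vge Q d ->
  tge Q f c -> tge Q (f * Q ^+ i) (c + i%:R * d).
Proof.
move=> Q1 Qd fc; elim: i => [|i IHi].
  by rewrite expr0 mulr1 mul0r addr0.
rewrite exprSr mulrA mulrS mulrDl mul1r [d + _]addrC addrA.
exact: tge_mulQ.
Qed.

Lemma tge_monom Q f i c : (1 < size Q)%N -> (size f < size Q)%N ->
  vge f c -> tge Q (f * Q ^+ i) (c + i%:R * rval Q).
Proof.
move=> Q1 fQ fc; apply: tge_mulXQ => //; last exact: tge_small.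
by apply: vge_rval => //; rewrite -size_poly_gt0 ltnW.
Qed.

Lemma tge_qcoef Q f c i : (1 < size Q)%N -> tge Q f c ->
  vge (qcoef Q f i) (c - i%:R * rval Q).
Proof.
move=> Q1 /(_ i); have Q0 : Q != 0 by rewrite -size_poly_gt0 ltnW.
by move=> /(vge_mulr nu_supp (expf_neq0 i Q0)); rewrite rvalX.
Qed.

Lemma tge_exists Q f : (1 < size Q)%N -> exists c, tge Q f c.
Proof.
move=> Q1; rewrite (qcoef_sum Q1 (leqnn (size f))).
move: (size f) => m; elim: m => [|n [c IHn]].
  by exists 0; rewrite big_ord0; apply: tge0.
rewrite big_ord_recr /=; have [->|a0] := eqVneq (qcoef Q f n) 0.
  by exists c; rewrite mul0r addr0.
exists (Num.min c (rval (qcoef Q f n) + n%:R * rval Q)).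
apply: tgeD; first by apply: tgeW IHn; rewrite ge_min lexx.
have := tge_monom n Q1 (size_qcoef f n Q1) (vge_rval nu_supp a0).
by apply: tgeW; rewrite ge_min lexx orbT.
Qed.

End Truncation.

(* The properties of Psi_alpha used in the proof: cofinally in Psi_alpha,
   carries in products of polynomials of degree less than alpha exceed the
   expected value by a uniform amount g. *)
Record gap_family (K : fieldType) (R : realType) (nu : valuation {poly K} R)
    (alpha : nat) (g : R) (Ps : {poly K} -> Prop) := GapFamily {
  gap_gt0 : 0 < g;
  gap_monic : forall Q, Ps Q -> Q \is monic;
  gap_alpha : (0 < alpha)%N;
  gap_size : forall Q : {poly K}, Ps Q -> size Q = alpha.+1;
  gap_carry : forall (Q a b : {poly K}) (c d : R), Ps Q -> (size a <= alpha)%N ->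
    (size b <= alpha)%N -> vge nu a c -> vge nu b d ->
    vge nu (a * b %/ Q * Q) (c + d + g);
  gap_nomax : forall Q, Ps Q -> exists2 Q', Ps Q' & rval nu Q < rval nu Q'
}.

(** * Truncations along a gap family *)

Section GapFamily.
Variables (K : fieldType) (R : realType) (nu : valuation {poly K} R).
Variables (alpha : nat) (g : R) (Ps : {poly K} -> Prop).
Hypotheses (nu_supp : trivial_support nu) (PsP : gap_family nu alpha g Ps).
Implicit Types (a b f h q Q F : {poly K}) (c d : R) (n : nat).
Local Notation vge := (vge nu).
Local Notation rval := (rval nu).
Local Notation tge := (tge nu).

Lemma Ps_size_gt1 Q : Ps Q -> (1 < size Q)%N.
Proof. by move=> /(gap_size PsP) ->; rewrite ltnS (gap_alpha PsP). Qed.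

Lemma Ps_neq0 Q : Ps Q -> Q != 0.
Proof. by move=> /Ps_size_gt1 Q1; rewrite -size_poly_gt0 ltnW. Qed.

Lemma Ps_vge Q : Ps Q -> vge Q (rval Q).
Proof. by move=> PQ; apply: vge_rval (Ps_neq0 PQ). Qed.

Lemma Ps_small Q : Ps Q -> forall n, (n <= alpha)%N = (n < size Q)%N.
Proof. by move=> PQ n; rewrite (gap_size PsP PQ) ltnS. Qed.

Lemma size_modp_Ps Q f : Ps Q -> (size (f %% Q)%R <= alpha)%N.
Proof. by move=> PQ; rewrite (Ps_small PQ) ltn_modp Ps_neq0. Qed.

Lemma size_qcoef_Ps Q f i : Ps Q -> (size (qcoef Q f i) <= alpha)%N.
Proof. by move=> PQ; rewrite (Ps_small PQ) size_qcoef// Ps_size_gt1. Qed.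

Lemma size_subQ Q Q' : Q \is monic -> size Q = alpha.+1 -> Ps Q' ->
  (size (Q - Q')%R <= alpha)%N.
Proof.
move=> Qm sQ PQ'.
exact: size_sub_monic Qm (gap_monic PsP PQ') sQ (gap_size PsP PQ').
Qed.

Lemma size_divp_mul_small Q a b : Ps Q -> (size a <= alpha)%N ->
  (size b <= alpha)%N -> (size (a * b %/ Q)%R <= alpha)%N.
Proof.
move=> PQ sa sb; rewrite size_divp ?Ps_neq0// (gap_size PsP PQ) /=.
rewrite leq_subLR (leq_trans (size_polyMleq a b))//.
by rewrite (leq_trans (leq_pred _))// leq_add.
Qed.

Lemma tge_carry Q a b c d : Ps Q -> (size a <= alpha)%N ->
  (size b <= alpha)%N -> vge a c -> vge b d ->
  tge Q (a * b %/ Q * Q) (c + d + g).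
Proof.
move=> PQ sa sb ac bd.
have := gap_carry PsP PQ sa sb ac bd.
move=> /(vge_mulr nu_supp (Ps_neq0 PQ)) H.
rewrite -[_ + g](subrK (rval Q)); apply: tge_mulQ; rewrite ?Ps_size_gt1//.
  exact: Ps_vge.
by apply: tge_small => //; rewrite -(Ps_small PQ) size_divp_mul_small.
Qed.

(** The carry is bounded by the gap, and the remainder is the product minus the carry, so neither
    falls below [c + d]. *)
Lemma tge_mul_small2 Q a b c d : Ps Q -> (size a <= alpha)%N ->
  (size b <= alpha)%N -> vge a c -> vge b d -> tge Q (a * b) (c + d).
Proof.
move=> PQ sa sb ac bd; have carry := tge_carry PQ sa sb ac bd.
have cdg : c + d <= c + d + g by rewrite lerDl ltW ?(gap_gt0 PsP).
rewrite {1}(divp_eq (a * b) Q); apply: tgeD; first exact: tgeW carry.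
apply: tge_small; rewrite -?(Ps_small PQ) ?size_modp_Ps//.
have -> : a * b %% Q = a * b - a * b %/ Q * Q.
  by rewrite {2}(divp_eq (a * b) Q) addrAC subrr add0r.
apply: vgeB; first exact: vgeM.
exact: vgeW cdg (tge_vge (Ps_size_gt1 PQ) carry).
Qed.

Lemma tge_mul_small Q a f c d : Ps Q -> (size a <= alpha)%N -> vge a c ->
  tge Q f d -> tge Q (a * f) (c + d).
Proof.
move=> PQ sa ac fd; have Q1 := Ps_size_gt1 PQ.
rewrite (qcoef_sum Q1 (leqnn (size f))) mulr_sumr; apply: tge_sum => i _.
rewrite mulrA -[d](subrK (i%:R * rval Q)) addrA.
apply: tge_mulXQ => //; first exact: Ps_vge.
by apply: tge_mul_small2 (tge_qcoef _ _ _ _) => //; apply: size_qcoef_Ps.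
Qed.

Lemma tgeM Q f h c d : Ps Q -> tge Q f c -> tge Q h d -> tge Q (f * h) (c + d).
Proof.
move=> PQ fc hd; have Q1 := Ps_size_gt1 PQ.
rewrite (qcoef_sum Q1 (leqnn (size f))) mulr_suml; apply: tge_sum => i _.
rewrite -[c](subrK (i%:R * rval Q)) mulrAC addrAC.
apply: tge_mulXQ => //; first exact: Ps_vge.
by apply: tge_mul_small (tge_qcoef _ _ _ _) _ => //; apply: size_qcoef_Ps.
Qed.

Lemma tgeX Q f c n : Ps Q -> tge Q f c -> tge Q (f ^+ n) (n%:R * c).
Proof.
move=> PQ fc; elim: n => [|n IHn].
  rewrite mul0r expr0; apply: tge_small; last exact: vge1.
  by rewrite size_poly1 Ps_size_gt1.
by rewrite exprS mulrS mulrDl mul1r; apply: tgeM.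
Qed.

Lemma vge_subQ Q Q' : Q \is monic -> Ps Q' -> rval Q <= rval Q' ->
  vge (Q - Q') (rval Q).
Proof.
move=> Qm PQ' l; apply: vgeB; last by apply: vgeW l _; apply: Ps_vge.
exact: vge_rval (monic_neq0 Qm).
Qed.

Lemma tgeQ Q Q' : Q \is monic -> size Q = alpha.+1 -> Ps Q' ->
  rval Q <= rval Q' -> tge Q' Q (rval Q).
Proof.
move=> Qm sQ PQ' l; rewrite -[X in tge _ X _](subrK Q' Q); apply: tgeD.
  by apply: tge_small; [rewrite -(Ps_small PQ') size_subQ|apply: vge_subQ].
apply: tgeW l _; rewrite -[X in tge _ X _]mul1r -[X in tge _ _ X]add0r.
apply: tge_mulQ; rewrite ?Ps_size_gt1//; first exact: Ps_vge.
by apply: tge_small; [rewrite size_poly1 Ps_size_gt1|apply: vge1].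
Qed.

(** [Q] is [Q'] plus a polynomial of degree less than [alpha], both of value at least [rval Q], so
    expanding powers of [Q] in [Q'] loses nothing. Stating this for monic [Q] of degree [alpha] also
    reaches key polynomials outside the cofinal part. *)
Lemma tge_mono_monic Q Q' f c : Q \is monic -> size Q = alpha.+1 -> Ps Q' ->
  rval Q <= rval Q' -> tge Q f c -> tge Q' f c.
Proof.
move=> Qm sQ PQ' l fc.
have Q1 : (1 < size Q)%N by rewrite sQ ltnS (gap_alpha PsP).
rewrite (qcoef_sum Q1 (leqnn (size f))); apply: tge_sum => i _.
rewrite -[c](subrK (i%:R * rval Q)).
apply: tgeM => //; last by apply: tgeX => //; apply: tgeQ.
apply: tge_small; last exact: tge_qcoef.
by rewrite (gap_size PsP PQ') -sQ size_qcoef.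
Qed.

Lemma tge_mono Q Q' f c : Ps Q -> Ps Q' -> rval Q <= rval Q' ->
  tge Q f c -> tge Q' f c.
Proof.
by move=> PQ; apply: tge_mono_monic (gap_monic PsP PQ) (gap_size PsP PQ).
Qed.

Lemma tge_hi Q f c : Ps Q -> tge Q f c -> tge Q (f - f %% Q) c.
Proof.
by move=> PQ fc; apply: tgeB => //; apply: tge_modp_small (Ps_size_gt1 PQ) _.
Qed.

(** One factor [h] at a time: the remainder times [h] has a carry gaining [g], and the carry
    accumulated so far keeps its gain when multiplied by [h]. *)
Lemma tge_carryX Q a h c d n : Ps Q -> (size a <= alpha)%N ->
  (size h <= alpha)%N -> vge a c -> vge h d ->
  tge Q (a * h ^+ n - a * h ^+ n %% Q) (c + n%:R * d + g).
Proof.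
move=> PQ sa sh ac hd; have Q1 := Ps_size_gt1 PQ.
elim: n => [|n IHn].
  rewrite expr0 mulr1 modp_small ?subrr -?(Ps_small PQ)//.
  exact: tge0.
set u := a * h ^+ n in IHn *; rewrite exprSr mulrA -/u.
have uc : vge (u %% Q) (c + n%:R * d).
  rewrite -[u %% Q](subKr u); apply: vgeB; first exact: vgeM (vgeX _ _).
  by apply: vgeW (tge_vge Q1 IHn); rewrite lerDl ltW ?(gap_gt0 PsP).
have -> : u * h - u * h %% Q =
    (u %% Q * h - (u %% Q * h) %% Q)
    + ((u - u %% Q) * h - ((u - u %% Q) * h) %% Q).
  by rewrite addrACA -opprD -modpD -mulrDl subrKC.
have -> : c + n.+1%:R * d + g = c + n%:R * d + d + g by rewrite mulrS; ring.
apply: tgeD.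
  rewrite {1}(divp_eq (u %% Q * h) Q) addrK.
  by apply: tge_carry => //; apply: size_modp_Ps.
apply: tge_hi => //.
have -> : c + n%:R * d + d + g = c + n%:R * d + g + d by ring.
by apply: tgeM => //; apply: tge_small => //; rewrite -(Ps_small PQ).
Qed.


(** * Unstable polynomials and their perturbations *)

(** Membership in [S_] tested on [Ps] only: the negated [tge] says that the truncation is below the
    value. *)
Definition unstable F := F != 0 /\ forall Q, Ps Q -> ~ tge Q F (rval F).
Definition tbound F B := forall Q c, Ps Q -> tge Q F c -> c <= B.

Lemma Ps_total Q Q' : Ps Q -> Ps Q' ->
  exists2 Q1, Ps Q1 & rval Q <= rval Q1 /\ rval Q' <= rval Q1.
Proof.
move=> PQ PQ'; have [l|/ltW l] := leP (rval Q) (rval Q'); first by exists Q'.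
by exists Q.
Qed.

(** If a truncation reached the value of [F - H], then at a later [Q1] the truncation of [F] would
    be at least the minimum of [rval F] and [c]. The first contradicts instability, the second the
    bound [B]. *)
Lemma unstable_perturb F H B Q c : unstable F -> tbound F B -> Ps Q ->
  tge Q H c -> B < c -> unstable (F - H).
Proof.
move=> [F0 Fu] FB PQ Hc Bc.
have FH0 : F - H != 0.
  apply/eqP => /subr0_eq FH; have := FB Q c PQ; rewrite FH leNgt Bc.
  by move=> /(_ Hc).
split=> // Q' PQ' FHu; have [Q1 PQ1 [l l']] := Ps_total PQ PQ'.
have {}Hc := tge_mono PQ PQ1 l Hc; have {}FHu := tge_mono PQ' PQ1 l' FHu.
have : tge Q1 F (Num.min (rval F) c).
  rewrite -[F](subrK H); apply: tgeD; last first.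
    by apply: tgeW Hc; rewrite ge_min lexx orbT.
  apply: tgeW FHu; rewrite subrK -vgeE//; apply: vgeB.
    by rewrite vgeE// ge_min lexx.
  apply: vgeW (tge_vge (Ps_size_gt1 PQ1) Hc).
  by rewrite ge_min lexx orbT.
have [Fc /Fu|cF Fc] := leP (rval F) c; first by move=> /(_ PQ1).
by have := FB _ _ PQ1 Fc; rewrite leNgt Bc.
Qed.

(** Truncations never exceed the value of [F], so they have a real supremum, which is [B]. *)
Lemma unstable_bound F : (exists Q, Ps Q) -> unstable F ->
  exists2 B, tbound F B & forall e, 0 < e ->
    exists Q c, [/\ Ps Q, tge Q F c & B - e < c].
Proof.
move=> [Q0 PQ0] [F0 Fu].
pose E := [set c | exists2 Q, Ps Q & tge Q F c]%classic.
have Eub : ubound E (rval F).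
  move=> c [Q PQ Fc]; rewrite -vgeE//.
  exact: tge_vge (Ps_size_gt1 PQ) Fc.
have Esup : has_sup E.
  split; last by exists (rval F).
  have [c Fc] := tge_exists nu_supp F (Ps_size_gt1 PQ0).
  by exists c, Q0.
exists (sup E) => [Q c PQ Fc|e e0].
  by apply: sup_upper_bound => //; exists Q.
by have [c [Q PQ Fc] cE] := sup_adherent e0 Esup; exists Q, c.
Qed.

Lemma unstable_size F : (exists Q, Ps Q) -> unstable F -> (alpha < size F)%N.
Proof.
move=> [Q PQ] [F0 /(_ Q PQ) Fu]; rewrite ltnNge; apply/negP => sF.
by apply: Fu; apply: tge_small; rewrite -?Ps_small//; apply: vge_rval.
Qed.

(** * Inverses modulo [Q] and comparison of two expansions *)

(** A proper factorization of [Q] would make [Q] the carry of its two factors, of value exactly the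
    sum of theirs, without the excess [g]. *)
Lemma Ps_coprime Q a : Ps Q -> a != 0 -> (size a <= alpha)%N -> coprimep a Q.
Proof.
move=> PQ a0 sa; rewrite /coprimep; set d := gcdp a Q.
have Q0 := Ps_neq0 PQ.
have d0 : d != 0 by rewrite gcdp_eq0 negb_and a0.
have dQ : d %| Q := dvdp_gcdr _ _.
have sd : (size d <= alpha)%N by apply: leq_trans sa; apply/dvdp_leq/dvdp_gcdl.
apply/negPn/negP => d1.
have d_gt1 : (1 < size d)%N.
  by rewrite ltn_neqAle eq_sym d1 size_poly_gt0.
pose u := Q %/ d; have Qud : u * d = Q by apply: divpK.
have u0 : u != 0 by apply: contraNneq Q0 => u0; rewrite -Qud u0 mul0r.
have su : (size u <= alpha)%N.
  rewrite size_divp// (gap_size PsP PQ) leq_subLR -add1n.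
  by rewrite leq_add2r -ltnS (ltn_predK d_gt1).
have := gap_carry PsP PQ su sd (vge_rval nu_supp u0) (vge_rval nu_supp d0).
rewrite Qud divpp// mul1r -rvalM// Qud vgeE// gerDl leNgt.
by rewrite (gap_gt0 PsP).
Qed.

Lemma Ps_inv Q a : Ps Q -> a != 0 -> (size a <= alpha)%N ->
  exists b, [/\ b != 0, (size b <= alpha)%N & b * a %% Q = 1].
Proof.
move=> PQ a0 sa; have Q1 := Ps_size_gt1 PQ; have Q0 := Ps_neq0 PQ.
have /Bezout_eq1_coprimepP [[u w] /= uw] := Ps_coprime PQ a0 sa.
have bE : (u %% Q) * a %% Q = 1.
  rewrite mulrC modp_mul mulrC -(modp_small (p := 1) (q := Q)) ?size_poly1//.
  by rewrite -uw modpD modp_mull addr0.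
exists (u %% Q); split=> //; last exact: size_modp_Ps.
by apply: contra_eq_neq bE => ->; rewrite mul0r mod0p eq_sym oner_eq0.
Qed.

(** With [b] an inverse of [a] modulo [Q] and [w] the carry of [b * a], one has
    [F = b * (a * F) - w * F]. The last term gains [g] over any known bound for [F], so finitely
    many iterations leave only the bound from the first. *)
Lemma tge_mul_smallK Q a F c : Ps Q -> a != 0 -> (size a <= alpha)%N ->
  tge Q (a * F) c -> tge Q F (c - rval a).
Proof.
move=> PQ a0 sa aFc; have g0 := gap_gt0 PsP.
have [b [b0 sb baE]] := Ps_inv PQ a0 sa.
have carry := tge_carry PQ sb sa (vge_rval nu_supp b0) (vge_rval nu_supp a0).
set w := b * a %/ Q * Q in carry.
have E1 : 1 = b * a - w.
  by rewrite -baE {2}(divp_eq (b * a) Q) addrAC subrr add0r.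
have ab0 : rval b + rval a = 0.
  have ba0 : b * a != 0 by rewrite mulf_neq0.
  have /(rval_dom nu_supp ba0) : vge (1 - b * a) (rval b + rval a + g).
    rewrite E1 addrAC subrr add0r; apply: vgeN.
    exact: tge_vge (Ps_size_gt1 PQ) carry.
  by rewrite rvalM// ltrDl => /(_ g0)[_ <-]; rewrite rval1.
rewrite ab0 add0r in carry.
have step d : tge Q F d -> tge Q F (Num.min (d + g) (c - rval a)).
  move=> Fd; rewrite -[F]mul1r E1 mulrBl -mulrA; apply: tgeB.
    have -> : c - rval a = rval b + c by lra.
    apply: (tgeW (d := rval b + c)); first by rewrite ge_min lexx orbT.
    exact: tge_mul_small (vge_rval nu_supp b0) aFc.
  apply: (tgeW (d := g + d)); first by rewrite addrC ge_min lexx.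
  exact: tgeM.
have [d Fd] := tge_exists nu_supp F (Ps_size_gt1 PQ).
have iter n : tge Q F (Num.min (d + n%:R * g) (c - rval a)).
  elim: n => [|n /step]; first by apply: tgeW Fd; rewrite mul0r addr0 ge_min lexx.
  apply: tgeW; rewrite le_min; apply/andP; split; last first.
    by rewrite ge_min lexx orbT.
  by case: (leP (d + n%:R * g) (c - rval a)) => l;
    rewrite ge_min -natr1; apply/orP; [left|right]; lra.
pose n := (Num.truncn ((c - rval a - d) / g)).+1.
apply: tgeW (iter n); rewrite le_min lexx andbT -lerBlDl -ler_pdivrMr//.
by apply/ltW/truncnS_gt.
Qed.

(** Put [k = Q - Q']. The difference of [Q ^+ i] and [k ^+ i] is a multiple of [Q'], and this gains
    [rval Q' - rval Q]; apart from their remainders, the terms in [k] contribute only carries, which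
    gain [g]. *)
Lemma tge_hi_gap Q Q' f c : Ps Q -> Ps Q' -> rval Q <= rval Q' ->
  tge Q f c -> tge Q' (f - f %% Q') (c + Num.min g (rval Q' - rval Q)).
Proof.
move=> PQ PQ' l fc; have Q1 := Ps_size_gt1 PQ.
have Qm := gap_monic PsP PQ; have sQ := gap_size PsP PQ.
set k := Q - Q'; have sk : (size k <= alpha)%N by apply: size_subQ.
have kv : vge k (rval Q) by apply: vge_subQ.
(* These are the remainders of the terms with [k] in place of [Q]; having degree less than [alpha],
   [w] can be subtracted without changing the part above the constant term. *)
pose w := \sum_(i < size f) (qcoef Q f i * k ^+ i) %% Q'.
have sw : (size w <= alpha)%N.
  apply: (leq_trans (size_sum _ _ _)).
  by apply/bigmax_leqP => i _; apply: size_modp_Ps.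
have wE : w %% Q' = w by rewrite modp_small -?Ps_small.
have -> : f - f %% Q' = (f - w) - (f - w) %% Q'.
  by rewrite modpD modpN wE opprD opprK addrACA addNr addr0.
apply: tge_hi => //; rewrite {1}(qcoef_sum Q1 (leqnn (size f))) -sumrB.
apply: tge_sum => i _.
have fi := tge_qcoef nu_supp i Q1 fc; set a := qcoef Q f i in fi *.
have sa : (size a <= alpha)%N by apply: size_qcoef_Ps.
rewrite -(subrK (a * k ^+ i) (a * Q ^+ i)) -addrA; apply: tgeD.
  apply: (tgeW (d := c + (rval Q' - rval Q))).
    by rewrite lerD2l ge_min lexx orbT.
  rewrite -mulrBr subrXX {1}/k subKr.
  case: (i : nat) fi => [|j] fi; first by rewrite big_ord0 !mulr0; apply: tge0.
  have -> : c + (rval Q' - rval Q) =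
      c - j.+1%:R * rval Q + (rval Q' + j%:R * rval Q) by rewrite mulrS; ring.
  apply: tge_mul_small => //; apply: tgeM => //.
    by apply: tgeQ; rewrite ?(gap_monic PsP) ?(gap_size PsP).
  apply: tge_sum => s _.
  have -> : j%:R * rval Q = (j.+1 - s.+1)%:R * rval Q + s%:R * rval Q.
    by rewrite -mulrDl -natrD subSS subnK// -ltnS.
  apply: tgeM => //; apply: tgeX => //; first exact: tgeQ.
  by apply: tge_small; rewrite -?Ps_small.
apply: (tgeW (d := c + g)); first by rewrite lerD2l ge_min lexx.
rewrite -[c](subrK (i%:R * rval Q)).
exact: tge_carryX.
Qed.

Lemma size_Ps_exp Q i : Ps Q -> size (Q ^+ i) = (i * alpha).+1.
Proof.
move=> PQ; rewrite polySpred ?expf_neq0 ?Ps_neq0//.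
by rewrite size_exp (gap_size PsP PQ) mulnC.
Qed.

Lemma size_sum_small Q n (c : nat -> {poly K}) : Ps Q ->
  (forall i, (size (c i) <= alpha)%N) ->
  (size (\sum_(i < n) c i * Q ^+ i)%R <= n * alpha)%N.
Proof.
move=> PQ sc; elim: n => [|n IHn]; first by rewrite big_ord0 size_poly0.
rewrite big_ord_recr /= (leq_trans (size_polyD _ _))// geq_max mulSn.
rewrite (leq_trans IHn) ?leq_addl//= (leq_trans (size_polyMleq _ _))//.
by rewrite size_Ps_exp// addnS /= leq_add2r.
Qed.

Lemma unstable_mul_small F B b : b != 0 -> (size b <= alpha)%N ->
  unstable F -> tbound F B ->
  unstable (b * F) /\ tbound (b * F) (rval b + B).
Proof.
move=> b0 sb [F0 Fu] FB; split.
  split; first by rewrite mulf_neq0.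
  move=> Q PQ /(tge_mul_smallK PQ b0 sb).
  by rewrite rvalM// addrC addKr; apply: Fu.
move=> Q c PQ /(tge_mul_smallK PQ b0 sb) /(FB _ _ PQ).
by rewrite lerBlDl.
Qed.

(* If the leading coefficient of the Q-expansion of F is a, multiply F by an
   inverse b of a modulo Q: dropping the carries gives an unstable polynomial
   with leading coefficient 1, which contradicts minimality unless a = 1. *)
Lemma minimal_leading F B Q c : F \is monic -> unstable F -> tbound F B ->
  (forall G, unstable G -> (size F <= size G)%N) ->
  Ps Q -> tge Q F c -> B < c + g ->
  exists n, [/\ (0 < n)%N, size F = (n * alpha).+1, qcoef Q F n = 1 &
    F = \sum_(i < n.+1) qcoef Q F i * Q ^+ i].
Proof.
move=> Fmon Fu FB Fmin PQ Fc Bc; have Q1 := Ps_size_gt1 PQ.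
have Q0 := Ps_neq0 PQ; have [F0 _] := Fu; have a_gt0 := gap_alpha PsP.
have sXQ i := size_Ps_exp i PQ.
pose n := ((size F).-1 %/ alpha)%N.
have sF : (n * alpha < size F)%N.
  by rewrite -[X in (_ < X)%N]prednK ?size_poly_gt0// ltnS leq_divM.
have sF' : (size F <= n.+1 * alpha)%N.
  by rewrite -[X in (X <= _)%N]prednK ?size_poly_gt0// ltn_ceil.
pose a := F %/ Q ^+ n.
have sa : size a = (size F - n * alpha)%N by rewrite size_divp ?expf_neq0// sXQ.
have sa' : (size a <= alpha)%N by rewrite sa leq_subLR addnC -mulSn.
have a0 : a != 0 by rewrite -size_poly_gt0 sa subn_gt0.
have anE : qcoef Q F n = a by rewrite /qcoef modp_small// -Ps_small.
have ageE i : (n < i)%N -> qcoef Q F i = 0.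
  move=> ni; rewrite /qcoef divp_small ?mod0p// sXQ ltnS.
  by rewrite (leq_trans sF')// leq_mul2r ni orbT.
have FE : F = \sum_(i < n.+1) qcoef Q F i * Q ^+ i.
  have nF : (n.+1 <= size F)%N by rewrite (leq_trans _ sF)// ltnS leq_pmulr.
  rewrite [LHS](qcoef_sum Q1 (leqnn (size F))).
  rewrite (big_ord_widen _ (fun i => qcoef Q F i * Q ^+ i) nF).
  rewrite [LHS](bigID (fun i : 'I_(size F) => (i < n.+1)%N)) /=.
  rewrite [X in _ + X]big1 ?addr0//.
  by move=> i; rewrite -leqNgt => /ageE ->; rewrite mul0r.
have [b [b0 sb baE]] := Ps_inv PQ a0 sa'.
pose G := \sum_(i < n.+1) (b * qcoef Q F i %% Q) * Q ^+ i.
have HE : b * F - G = \sum_(i < n.+1) (b * qcoef Q F i %/ Q * Q) * Q ^+ i.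
  rewrite [in b * F]FE mulr_sumr -sumrB; apply: eq_bigr => i _.
  by rewrite mulrA -mulrBl {1}(divp_eq (b * qcoef Q F i) Q) addrK.
have Hc : tge Q (b * F - G) (rval b + (c + g)).
  rewrite HE; apply: tge_sum => i _.
  have -> : rval b + (c + g) = rval b + (c - i%:R * rval Q) + g + i%:R * rval Q.
    by ring.
  apply: tge_mulXQ => //; first exact: Ps_vge.
  apply: tge_carry => //; first exact: size_qcoef_Ps.
    exact: vge_rval.
  exact: tge_qcoef.
have [bFu bFB] := unstable_mul_small b0 sb Fu FB.
have : unstable (b * F - (b * F - G)).
  by apply: unstable_perturb bFu bFB PQ Hc _; rewrite ltrD2l.
rewrite subKr => /Fmin; rewrite /G big_ord_recr /= anE baE mul1r => sG.
have sFE : size F = (n * alpha).+1.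
  apply/eqP; rewrite eqn_leq sF andbT (leq_trans sG)//.
  rewrite (leq_trans (size_polyD _ _))// geq_max sXQ leqnn andbT ltnW// ltnS.
  exact: (size_sum_small n PQ (fun i => size_modp_Ps (b * qcoef Q F i) PQ)).
(* By minimality the degrees agree, so [a] is constant; as [F] and [Q] are monic, it is 1. *)
have aE : a = 1.
  have sa1 : size a == 1%N by rewrite sa sFE subSnn.
  have [u _ au] := size_poly1P _ sa1.
  have : lead_coef F = 1 by apply/eqP.
  rewrite FE big_ord_recr /= anE lead_coefDr; last first.
    rewrite size_mul ?expf_neq0// (eqP sa1) sXQ /= ltnS.
    exact: (size_sum_small n PQ (fun i => size_qcoef_Ps F i PQ)).
  rewrite lead_coefM lead_coef_exp (eqP (gap_monic PsP PQ)) expr1n mulr1.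
  by rewrite au lead_coefC => ->.
exists n; split=> //; last by rewrite anE.
have : (alpha < size F)%N by apply: unstable_size Fu; exists Q.
rewrite sFE ltnS; apply: contraTT.
by rewrite -eqn0Ngt -ltnNge => /eqP ->; rewrite mul0n.
Qed.

(** * Re-expansion of [F] in powers of [Q] and removal of terms *)

Section Expansion.
Variables (F Q0 : {poly K}) (n : nat) (b0 : R).
Hypotheses (PQ0 : Ps Q0) (Fb0 : tge Q0 F b0).
Hypothesis FE : F = \sum_(i < n.+1) qcoef Q0 F i * Q0 ^+ i.

(* F = digits.[Q0], and its Hasse derivatives are taken at Q0 (tcoef) and, up to
   a multiple of Q, at the approximation Q0 - Q of Q0 (ecoef). *)
Definition digits : {poly {poly K}} := \poly_(i < n.+1) qcoef Q0 F i.
Definition tcoef i := digits^`N(i).[Q0].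
Definition ecoef Q i := digits^`N(i).[Q0 - Q] %% Q.

Lemma size_digits_coef i : (size (digits`_i)%R <= alpha)%N.
Proof.
by rewrite coef_poly; case: ifP => _; rewrite ?size_poly0//; apply: size_qcoef_Ps.
Qed.

Lemma vge_digits_coef i : vge digits`_i (b0 - i%:R * rval Q0).
Proof.
rewrite coef_poly; case: ifP => _; last exact: vge0.
by apply: tge_qcoef (Ps_size_gt1 PQ0) Fb0.
Qed.

Lemma size_nderivn_digits i : (size (digits^`N(i))%R <= n.+1 - i)%N.
Proof.
apply/leq_sizeP => j ij; rewrite coef_nderivn coef_poly ifF ?mul0rn//.
by apply/negbTE; rewrite -leqNgt; move: ij; rewrite leq_subLR.
Qed.

Lemma tcoef0 : tcoef 0 = F.
Proof.
rewrite /tcoef nderivn0 (horner_coef_wide _ (size_poly _ _)) [RHS]FE.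
by apply: eq_bigr => i _; rewrite coef_poly ltn_ord.
Qed.

Lemma size_tcoef i : (0 < i)%N -> (size (tcoef i) <= n * alpha)%N.
Proof.
move=> i0; have s : (size (digits^`N(i))%R <= n)%N.
  apply: (leq_trans (size_nderivn_digits i)).
  by rewrite leq_subLR -add1n leq_add2r.
rewrite /tcoef (horner_coef_wide _ s); apply: size_sum_small => // j.
rewrite coef_nderivn (leq_trans _ (size_digits_coef (i + j)))//.
exact: size_polyMn_leq.
Qed.

Lemma tcoef_taylor Q m : tcoef m =
  \sum_(j < n.+1) digits^`N(m + j).[Q0 - Q] *+ 'C(m + j, m) * Q ^+ j.
Proof.
have s : (size (digits^`N(m))%R <= n.+1)%N.
  by apply: (leq_trans (size_nderivn_digits m)); rewrite leq_subr.
rewrite /tcoef -{1}(subrK Q Q0) (nderiv_taylor_wide (mulrC _ _) s).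
by apply: eq_bigr => j _; rewrite nderivn_nderivn hornerMn.
Qed.

Lemma ecoefE Q i : ecoef Q i = tcoef i %% Q.
Proof.
rewrite (tcoef_taylor Q) big_ord_recl addn0 binn mulr1n expr0 mulr1 modpD.
rewrite (eq_bigr (fun j : 'I_n => digits^`N(i + j.+1).[Q0 - Q] *+
    'C(i + j.+1, i) * Q ^+ j * Q)).
  by rewrite -mulr_suml modp_mull addr0.
by move=> j _; rewrite lift0 exprSr mulrA.
Qed.

(** The Hasse derivative at [Q0 - Q] is a sum of multiples of a digit times a power of [Q0 - Q].
    Digit and base have degree less than [alpha], so subtracting the remainder leaves carries, each
    gaining [g]. *)
Lemma ecoef_err Q i : Ps Q -> rval Q0 <= rval Q ->
  tge Q (digits^`N(i).[Q0 - Q] - ecoef Q i) (b0 + g - i%:R * rval Q).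
Proof.
move=> PQ l; apply: (tgeW (d := b0 + g - i%:R * rval Q0)).
  by rewrite lerB// ler_wpM2l.
have s : (size (digits^`N(i))%R <= n.+1)%N.
  by apply: (leq_trans (size_nderivn_digits i)); rewrite leq_subr.
rewrite /ecoef (horner_coef_wide _ s) (big_morph _ (modpD Q) (mod0p Q)) -sumrB.
apply: tge_sum => j _; rewrite coef_nderivn.
rewrite [_ * (_ - _) ^+ _]mulrnAl modpMn -mulrnBl; apply: tgeMn.
have -> : b0 + g - i%:R * rval Q0 =
   b0 - (i + j)%:R * rval Q0 + j%:R * rval Q0 + g by rewrite natrD; ring.
have Qm0 := gap_monic PsP PQ0; have sQ0 := gap_size PsP PQ0.
apply: tge_carryX => //; [exact: size_digits_coef|exact: size_subQ|
  exact: vge_digits_coef|exact: vge_subQ].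
Qed.

Lemma tcoef_expand Q m : Ps Q -> rval Q0 <= rval Q ->
  tge Q (tcoef m - \sum_(j < n.+1) ecoef Q (m + j) *+ 'C(m + j, m) * Q ^+ j)
    (b0 + g - m%:R * rval Q).
Proof.
move=> PQ l; rewrite (tcoef_taylor Q) -sumrB; apply: tge_sum => j _.
rewrite -mulrBl -mulrnBl.
have -> : b0 + g - m%:R * rval Q = b0 + g - (m + j)%:R * rval Q + j%:R * rval Q.
  by rewrite natrD; ring.
apply: (tge_mulXQ _ (Ps_size_gt1 PQ) (Ps_vge PQ)); apply: tgeMn.
exact: ecoef_err.
Qed.

Lemma size_ecoef Q i : Ps Q -> (size (ecoef Q i) <= alpha)%N.
Proof. exact: size_modp_Ps. Qed.

(** Up to the error in [tcoef_expand], the sum there is the [Q]-expansion of [tcoef m], so a bound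
    on the truncation bounds each coefficient. *)
Lemma ecoef_ge Q m j c : Ps Q -> rval Q0 <= rval Q -> (j <= n)%N ->
  tge Q (tcoef m) c ->
  vge (ecoef Q (m + j) *+ 'C(m + j, m))
    (Num.min c (b0 + g - m%:R * rval Q) - j%:R * rval Q).
Proof.
move=> PQ l jn mc; set M := Num.min _ _; have Q1 := Ps_size_gt1 PQ.
pose e i := ecoef Q (m + i) *+ 'C(m + i, m).
have : tge Q (\sum_(i < n.+1) e i * Q ^+ i) M.
  rewrite -[X in tge _ X _](subKr (tcoef m)); apply: tgeB.
    by apply: tgeW mc; rewrite ge_min lexx.
  by apply: tgeW (tcoef_expand m PQ l); rewrite ge_min lexx orbT.
move=> /(tge_qcoef nu_supp j Q1); rewrite qcoef_uniq ?ltnS ?jn//= => i.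
by rewrite -Ps_small// (leq_trans (size_polyMn_leq _ _))// size_ecoef.
Qed.

(** If the truncation on [Q2] reaches the value, then for [Q] of strictly larger value the part
    above the constant term exceeds it by [tge_hi_gap], and the remainder alone has the value. *)
Lemma tcoef_stable i : ~ unstable (tcoef i) -> tcoef i != 0 ->
  exists2 Q1, Ps Q1 & forall Q, Ps Q -> rval Q1 <= rval Q ->
    [/\ tge Q (tcoef i) (rval (tcoef i)), ecoef Q i != 0 &
        rval (ecoef Q i) = rval (tcoef i)].
Proof.
move=> fu f0.
have [Q2 [PQ2 fQ2]] : exists Q, Ps Q /\ tge Q (tcoef i) (rval (tcoef i)).
  apply: contrapT => H; apply: fu; split=> // Q PQ fQ; apply: H.
  by exists Q.
have [Q1 PQ1 Q21] := gap_nomax PsP PQ2; exists Q1 => // Q PQ l.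
have Q2Q : rval Q2 < rval Q := lt_le_trans Q21 l.
have fQ := tge_mono PQ2 PQ (ltW Q2Q) fQ2.
have hi := tge_vge (Ps_size_gt1 PQ) (tge_hi_gap PQ2 PQ (ltW Q2Q) fQ2).
have pos : rval (tcoef i) < rval (tcoef i) + Num.min g (rval Q - rval Q2).
  by rewrite ltrDl lt_min (gap_gt0 PsP) subr_gt0.
rewrite ecoefE.
have [|e0 eE] := rval_dom nu_supp f0 pos (g := tcoef i %% Q); last by split.
by rewrite -opprB; apply: vgeN.
Qed.

Hypothesis Fu : unstable F.
Hypothesis sF : size F = (n * alpha).+1.
Hypothesis Fmin : forall G, unstable G -> (size F <= size G)%N.
Hypothesis Fn : qcoef Q0 F n = 1.
Variable B : R.
Hypotheses (FB : tbound F B) (Bb0 : B < b0 + g).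
Hypothesis Fsup : forall e, 0 < e ->
  exists Q c, [/\ Ps Q, tge Q F c & B - e < c].

Lemma tcoef_not_unstable i : (0 < i)%N -> ~ unstable (tcoef i).
Proof.
by move=> i0 /Fmin; rewrite sF ltnNge size_tcoef.
Qed.

Lemma tcoef_eventually i : (0 < i)%N -> tcoef i = 0 \/
  exists2 Q1, Ps Q1 & forall Q, Ps Q -> rval Q1 <= rval Q ->
    [/\ tge Q (tcoef i) (rval (tcoef i)), ecoef Q i != 0 &
        rval (ecoef Q i) = rval (tcoef i)].
Proof.
move=> i0; have [->|f0] := eqVneq (tcoef i) 0; first by left.
by right; apply: tcoef_stable => //; apply: tcoef_not_unstable.
Qed.

(* The lines rval (tcoef i) + i t and rval (tcoef m) + m t, for t = rval Q: the
   first one lies above the second one (as 'C(i, m) is a unit) and has larger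
   slope, so it gets above B, the limit of the values of F. *)
Lemma ecoef_large m i : (0 < m < i)%N -> (i <= n)%N ->
  (forall h c, vge (h *+ 'C(i, m)) c -> vge h c) ->
  exists2 c, B < c & exists2 Q1, Ps Q1 & forall Q, Ps Q -> rval Q1 <= rval Q ->
    vge (ecoef Q i) (c - i%:R * rval Q).
Proof.
move=> /andP[m0 mi] i_n unit; have i0 : (0 < i)%N by apply: ltn_trans mi.
have [fi0|[Qi PQi Hi]] := tcoef_eventually i0.
  exists (B + 1); first by rewrite ltrDl.
  by exists Q0 => // Q PQ _; rewrite ecoefE fi0 mod0p; apply: vge0.
have bigQ Q : Ps Q -> rval Qi <= rval Q -> B < rval (tcoef i) + i%:R * rval Q ->
  exists2 c, B < c & exists2 Q1, Ps Q1 & forall Q, Ps Q -> rval Q1 <= rval Q ->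
    vge (ecoef Q i) (c - i%:R * rval Q).
  move=> PQ QiQ BQ; exists (rval (tcoef i) + i%:R * rval Q) => //.
  exists Q => // Q' PQ' QQ'; have [_ e0 eE] := Hi _ PQ' (le_trans QiQ QQ').
  by rewrite vgeE// eE lerBlDr lerD2l ler_wpM2l.
have [Q01 PQ01 [Q0Q01 QiQ01]] := Ps_total PQ0 PQi.
have mi_n : (i - m <= n)%N by rewrite (leq_trans (leq_subr _ _)).
have lower Q c : Ps Q -> rval Q01 <= rval Q -> tge Q (tcoef m) c ->
    Num.min c (b0 + g - m%:R * rval Q) - (i - m)%:R * rval Q <= rval (tcoef i).
  move=> PQ l fm; have [_ e0 <-] := Hi _ PQ (le_trans QiQ01 l).
  have := ecoef_ge PQ (le_trans Q0Q01 l) mi_n fm.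
  by rewrite subnKC ?(ltnW mi)// => /unit; rewrite vgeE.
have natB : (i - m)%:R = i%:R - m%:R :> R by rewrite natrB ?(ltnW mi).
(* If [tcoef m] is zero, only the error term of [ecoef_ge] remains, and [b0 + g] exceeds [B]. *)
have [fm0|[Qm PQm Hm]] := tcoef_eventually m0.
  apply: (bigQ Q01) => //.
  have := lower _ (b0 + g - m%:R * rval Q01) PQ01 (lexx _).
  rewrite fm0 => /(_ (tge0 _ _ _)).
  rewrite minxx natB mulrBl.
  move: Bb0 (rval (tcoef i)) (i%:R * rval Q01) (m%:R * rval Q01).
  by move=> *; lra.
have [Q1 PQ1 [Q01Q1 QmQ1]] := Ps_total PQ01 PQm.
have [Bi|iB] := ltP B (rval (tcoef i) + i%:R * rval Q1).
  by apply: (bigQ Q1) => //; apply: le_trans Q01Q1.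
have [fm em0 emE] := Hm _ PQ1 QmQ1.
(* The minimum in [lower] is not the error term, which would put the line of [i] above [B] already
   at [Q1]. *)
have {lower} low : rval (tcoef m) - (i - m)%:R * rval Q1 <= rval (tcoef i).
  have := lower _ _ PQ1 Q01Q1 fm; case: (leP (rval (tcoef m)) _) => // _.
  rewrite natB mulrBl.
  move: Bb0 iB; move: (rval (tcoef i)) (rval (tcoef m)) => ti tm.
  by move: (i%:R * rval Q1) (m%:R * rval Q1) => x y *; lra.
have [Q2 PQ2 Q12] := gap_nomax PsP PQ1.
(* The gain of the line of [i] over the line of [m] between [Q1] and [Q2]. A truncation of [F]
   within [e] of [B] keeps the line of [m] above [B - e]. *)
pose e := (i - m)%:R * (rval Q2 - rval Q1).
have e0 : 0 < e by rewrite mulr_gt0 ?subr_gt0// ltr0n subn_gt0.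
have [Q3 [c [PQ3 Fc3 cB]]] := Fsup e0.
have [Q PQ [Q2Q Q3Q]] := Ps_total PQ2 PQ3.
have Q1Q := le_trans (ltW Q12) Q2Q.
have Fc := tge_mono PQ3 PQ Q3Q Fc3; have cleB := FB PQ Fc.
apply: (bigQ Q) => //; first by apply: le_trans (le_trans QiQ01 Q01Q1) Q1Q.
have [_ em0' emE'] := Hm _ PQ (le_trans QmQ1 Q1Q).
have m_n : (m <= n)%N by rewrite (leq_trans (ltnW mi)).
have l0 := le_trans (le_trans Q0Q01 Q01Q1) Q1Q.
have := ecoef_ge (m := 0) (c := c) PQ l0 m_n; rewrite tcoef0 => /(_ Fc).
rewrite add0n bin0 mulr1n mul0r subr0 min_l; last first.
  exact: le_trans cleB (ltW Bb0).
rewrite vgeE// emE' => mQ.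
have : (i - m)%:R * (rval Q2 - rval Q1) <= (i - m)%:R * (rval Q - rval Q1).
  by rewrite ler_wpM2l// lerB.
move: cB mQ low; rewrite /e natB !mulrBl !mulrBr.
move: (rval (tcoef i)) (rval (tcoef m)) => ti tm.
by move: (_ * rval Q) (_ * rval Q) (_ * rval Q1) (_ * rval Q1) => x y z t *; lra.
Qed.

(** The indices of the terms to keep, later 0 and the powers of [p]. *)
Variable P : pred nat.
Hypothesis P0 : P 0%N.
Hypothesis Pbin : forall i, (0 < i)%N -> ~~ P i ->
  exists2 m, (0 < m < i)%N & forall h c, vge (h *+ 'C(i, m)) c -> vge h c.

Lemma ecoef_large_all N : (N <= n.+1)%N ->
  exists2 c, B < c & exists2 Q1, Ps Q1 & forall Q, Ps Q -> rval Q1 <= rval Q ->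
    forall i, (i < N)%N -> ~~ P i -> vge (ecoef Q i) (c - i%:R * rval Q).
Proof.
elim: N => [|N IHN] Nn; first by exists (B + 1); [rewrite ltrDl|exists Q0].
have [c Bc [Q1 PQ1 H1]] := IHN (ltnW Nn).
have [PN|PN] := boolP (P N).
  exists c => //; exists Q1 => // Q PQ l i; rewrite ltnS leq_eqVlt.
  by case/predU1P=> [->|iN]; [rewrite PN|apply: H1].
have N0 : (0 < N)%N by rewrite lt0n; apply: contraNneq PN => ->.
have [m mN unit] := Pbin N0 PN.
have [c' Bc' [Q2 PQ2 H2]] := ecoef_large mN Nn unit.
have [Q3 PQ3 [Q13 Q23]] := Ps_total PQ1 PQ2.
exists (Num.min c c'); first by rewrite lt_min Bc.
exists Q3 => // Q PQ l i; rewrite ltnS leq_eqVlt => /predU1P[->|iN] Pi.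
  by apply: vgeW (H2 _ PQ (le_trans Q23 l)); rewrite lerB// ge_min lexx orbT.
by apply: vgeW (H1 _ PQ (le_trans Q13 l) _ iN Pi); rewrite lerB// ge_min lexx.
Qed.

Lemma sparse_expansion : P n /\ exists Q (c : nat -> {poly K}),
  [/\ Ps Q, forall i, (size (c i) <= alpha)%N, c n = 1,
      forall i, ~~ P i -> c i = 0 &
      unstable (\sum_(i < n.+1) c i * Q ^+ i)].
Proof.
have [c Bc [Q1 PQ1 H1]] := ecoef_large_all (leqnn _).
have [Q PQ [Q0Q Q1Q]] := Ps_total PQ0 PQ1.
pose d i := if P i then ecoef Q i else 0.
have sd i : (size (d i) <= alpha)%N.
  by rewrite /d; case: ifP => _; rewrite ?size_poly0// size_ecoef.
pose G := \sum_(i < n.+1) d i * Q ^+ i.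
have HE : F - G = (F - \sum_(i < n.+1) ecoef Q i * Q ^+ i)
    + \sum_(i < n.+1) (if P i then 0 else ecoef Q i) * Q ^+ i.
  rewrite [X in F - X + _](_ : _ = G + \sum_(i < n.+1)
    (if P i then 0 else ecoef Q i) * Q ^+ i); first by rewrite opprD addrA subrK.
  rewrite -big_split; apply: eq_bigr => i _ /=.
  by rewrite -mulrDl /d; case: ifP => _; rewrite ?addr0 ?add0r.
have : tge Q (F - G) (Num.min (b0 + g) c).
  rewrite HE; apply: tgeD.
    apply: (tgeW (d := b0 + g)); first by rewrite ge_min lexx.
    have := tcoef_expand 0 PQ Q0Q; rewrite tcoef0 mul0r subr0.
    by congr (tge _ (_ - _) _); apply: eq_bigr => i _; rewrite bin0.
  apply: (tgeW (d := c)); first by rewrite ge_min lexx orbT.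
  apply: tge_sum => i _; rewrite -[c](subrK (i%:R * rval Q)).
  apply: (tge_mulXQ _ (Ps_size_gt1 PQ) (Ps_vge PQ)).
  case: ifP => [_|/negbT Pi]; first exact: tge0.
  by apply: tge_small; [rewrite -Ps_small ?size_ecoef|apply: H1].
move=> /(unstable_perturb Fu FB PQ); rewrite lt_min Bb0 Bc subKr => /(_ isT) Gu.
(* Without its top term [G] would have smaller degree than [F]. *)
have Pn : P n.
  apply/negPn/negP => Pn; have := Fmin Gu; rewrite sF ltnNge => /negP; apply.
  rewrite /G big_ord_recr /= {2}/d (negPf Pn) mul0r addr0.
  exact: (size_sum_small n PQ sd).
split=> //; exists Q, d; split=> // [|i /negPf Pi]; last by rewrite /d Pi.
rewrite /d Pn /ecoef; have -> : digits^`N(n) = 1.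
  apply/polyP => j; rewrite coef_nderivn coef_poly coef1.
  case: j => [|j]; first by rewrite addn0 ltnSn Fn binn.
  by rewrite addnS ltnS -ltn_subRL subnn ltn0 mul0rn.
by rewrite hornerC modp_small// size_poly1 Ps_size_gt1.
Qed.

End Expansion.

End GapFamily.

(** * Binomial coefficients and the characteristic exponent *)

(** Over ['F_p], the power [p ^ t * u] of [1 + X] is the power [u] of [1 + X^(p ^ t)]; comparing
    coefficients of [X^(p ^ t)] shows that the binomial coefficient is [u] modulo [p]. *)
Lemma prime_bin_ndvd (p t u : nat) : prime p -> ~~ (p %| u)%N ->
  ~~ (p %| 'C(p ^ t * u, p ^ t))%N.
Proof.
move=> pp pu; have chp := pchar_Fp pp.
have chP : p \in [pchar {poly 'F_p}].
  by rewrite inE pp -polyC_natr polyC_eq0 /= -(dvdn_pcharf chp) dvdnn.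
have mt : (0 < p ^ t)%N by rewrite expn_gt0 prime_gt0.
suff E : 'C(p ^ t * u, p ^ t)%:R = u%:R :> 'F_p 
  by rewrite (dvdn_pcharf chp) E -(dvdn_pcharf chp).
have u0 : (0 < u)%N by rewrite lt0n; apply: contraNneq pu => ->.
have E : (1 + 'X^1 : {poly 'F_p}) ^+ (p ^ t * u) = (1 + 'X^(p ^ t)) ^+ u.
  rewrite exprM exprDn_pchar ?expr1n// pnatX.
  by rewrite (eq_pnat _ (pcharf_eq chP)) pnat_id.
have coefn (n k m : nat) (m0 : (0 < m)%N) : (k <= n)%N ->
    ((1 + 'X^m : {poly 'F_p}) ^+ n)`_(m * k) = 'C(n, k)%:R.
  move=> kn; rewrite exprDn coef_sum (bigD1 (Ordinal (kn : (k < n.+1)%N))) //=.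
  rewrite big1 ?addr0 => [|j jk]; rewrite expr1n mul1r coefMn -exprM coefXn.
    by rewrite eqxx.
  by rewrite eqn_pmul2l// -val_eqE eq_sym in jk *; rewrite (negPf jk) mul0rn.
have := coefn (p ^ t * u)%N (p ^ t)%N 1%N isT (leq_pmulr _ u0).
rewrite mul1n E => <-.
by have := coefn u 1%N (p ^ t)%N mt u0; rewrite muln1 bin1.
Qed.

Lemma residue_nat_val (K : fieldType) (R : realType) (v : valuation K R) n :
  n%:R != 0 :> residue v -> v n%:R = 0%E.
Proof.
have -> : n%:R = (\pi_(residue v) n%:R)%qT.
  by rewrite (rmorph_nat (\pi_(residue v))%qT).
rewrite residue_eq0 -leNgt; have -> : int_val (n%:R : val_int v) = n%:R.
  by elim: n => [|n IHn] //; rewrite !mulrS -IHn.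
move=> nv; apply/eqP; rewrite eq_le nv /=.
have : (n%:R : K) \in val_ring v by apply: rpred_nat.
by rewrite inE.
Qed.

(** The index 0 is included because the constant term is kept; for [p = 1] the only other index is
    1. *)
Definition p_power p : pred nat := [pred i | (i == 0) || (i == p ^ logn p i)]%N.

(** An integer nonzero in the residue field has value 0, so multiplying by it changes no value. For
    [p = 1] the choice is [m = 1], with binomial coefficient [i]. *)
Lemma char_exponent_bin (K : fieldType) (R : realType)
    (nu : valuation {poly K} R) p i :
  char_exponent nu p -> (0 < i)%N -> ~~ p_power p i ->
  exists2 m, (0 < m < i)%N & forall h c, vge nu (h *+ 'C(i, m)) c -> vge nu h c.
Proof.
move=> chp i0; rewrite /p_power /= negb_or => /andP[_ ip].
have unit n : n%:R != 0 :> residue (val_const nu) ->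
    forall h c, vge nu (h *+ n) c -> vge nu h c.
  move=> /residue_nat_val n0 h c.
  rewrite /vge -[h *+ n]mulr_natl valuationM -polyC_natr.
  by have -> : nu n%:R%:P = 0%E by []; rewrite add0e.
case: chp => [chp|[p1 ch0]]; last first.
  exists 1%N; last first.
    apply: unit; rewrite bin1; apply/negP => /(natf0_pchar i0)[q].
    by rewrite ch0.
  by rewrite /= ltn_neqAle eq_sym i0 andbT; move: ip; rewrite p1 exp1n.
have pp : prime p := pcharf_prime chp.
have [u pu iE] := pfactor_coprime pp i0.
exists (p ^ logn p i)%N.
  rewrite expn_gt0 prime_gt0//= ltn_neqAle eq_sym ip.
  by rewrite dvdn_leq// pfactor_dvdnn.
apply: unit; rewrite -(dvdn_pcharf chp) {1}iE mulnC.
by apply: prime_bin_ndvd; rewrite -?prime_coprime.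
Qed.

(** * Levels of key polynomials and the gap they produce *)

Lemma nderivnM (A : comNzRingType) (f h : {poly A}) n :
  (f * h)^`N(n) = \sum_(i < n.+1) f^`N(i) * h^`N(n - i).
Proof.
have nX q m : (q * 'X)^`N(m.+1) = q^`N(m) + q^`N(m.+1) * 'X.
  by have := nderivnMXaddC m q 0; rewrite polyC0 addr0.
elim/poly_ind: f n => [|f a IHf] n.
  by rewrite mul0r linear0 big1 => // i _; rewrite linear0 mul0r.
case: n => [|n]; first by rewrite big_ord1 !nderivn0.
rewrite mulrDl nderivnD mulrAC nX mul_polyC nderivnZ !IHf.
rewrite [X in X * 'X]big_ord_recl [RHS]big_ord_recl /= !nderivn0 !subn0.
have -> : \sum_(i < n.+1)
      (f * 'X + a%:P)^`N(lift ord0 i) * h^`N(n.+1 - lift ord0 i) =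
    \sum_(i < n.+1) f^`N(i) * h^`N(n - i) +
    (\sum_(i < n.+1) f^`N(lift ord0 i) * h^`N(n.+1 - lift ord0 i)) * 'X.
  rewrite mulr_suml -big_split; apply: eq_bigr => i _ /=.
  by rewrite nderivnD nX nderivnC addr0 /bump /= subSS; ring.
by rewrite -mul_polyC; ring.
Qed.

Section Levels.
Variables (K : fieldType) (R : realType) (nu : valuation {poly K} R).
Hypothesis nu_supp : trivial_support nu.
Implicit Types (a b f h q Q F : {poly K}) (c d : R) (n : nat).
Local Notation vge := (vge nu).
Local Notation rval := (rval nu).
Local Notation tge := (tge nu).

(** The maximum is over finitely many orders, and it is not [-oo] because the derivative of order
    the degree of [Q] is the leading coefficient. *)
Lemma level_attained Q : (1 < size Q)%N -> exists (t : nat) e,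
  [/\ (0 < t)%N, level nu Q = e%:E, Q^`N(t) != 0 &
      rval Q^`N(t) = rval Q - t%:R * e].
Proof.
move=> Q1; have Q0 : Q != 0 by rewrite -size_poly_gt0 ltnW.
pose slope t := ((nu Q - nu Q^`N(t)) * (t%:R^-1)%:E)%E.
have n0 : (0 < (size Q).-1)%N by rewrite -ltnS prednK// ltnW.
have lNy : level nu Q != -oo%E.
  rewrite -leeNy_eq -ltNge; apply: lt_le_trans (level_ub nu Q n0).
  have D0 : Q^`N((size Q).-1) != 0.
    apply/eqP => /(congr1 (fun q : {poly K} => q`_0)).
    rewrite coef_nderivn addn0 binn coef0 => /eqP.
    by rewrite -lead_coefE lead_coef_eq0 (negPf Q0).
  by rewrite !rvalE// -EFinB -EFinM ltNyr.
have [lN|[t t0 lt]] :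
    level nu Q = -oo%E \/ exists2 t, (0 < t)%N & level nu Q = slope t.
  rewrite /level big_seq; elim/big_ind: _ => [|x y|t]; first by left.
    move=> [->|[t t0 ->]]; first by rewrite maxNye.
    move=> [->|[t' t0' ->]]; first by right; exists t; rewrite ?maxeNy.
    by right; have [_|_] := leP (slope t) (slope t'); [exists t'|exists t].
  by rewrite mem_index_iota => /andP[t0 _]; right; exists t.
- by rewrite lN eqxx in lNy.
have D0 : Q^`N(t) != 0.
  apply: contraNneq lNy => D0; rewrite lt /slope D0 valuation0 /= addeNy.
  by rewrite mulNyr gtr0_sg ?invr_gt0 ?ltr0n// mul1e.
exists t, ((rval Q - rval Q^`N(t)) / t%:R); split=> //.
  by rewrite lt /slope !rvalE.
by rewrite mulrC divfK ?subKr// pnatr_eq0 -lt0n.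
Qed.

Lemma level_vge f e (b : nat) : f != 0 -> (level nu f <= e%:E)%E ->
  vge f^`N(b) (rval f - b%:R * e).
Proof.
move=> f0 fe; case: b => [|b].
  by rewrite nderivn0 mul0r subr0; apply: vge_rval.
have [->|D0] := eqVneq f^`N(b.+1) 0; first exact: vge0.
have := le_trans (level_ub nu f (ltn0Sn b)) fe.
rewrite !rvalE// vgeE// -EFinB -EFinM lee_fin ler_pdivrMr ?ltr0n// mulrC.
by rewrite lerBlDr lerBlDl addrC.
Qed.

(** Otherwise [Q'] is the sum of [Q] and a polynomial of degree less than [alpha], both of level at
    most that of [Q] and of value at least [rval Q']; the derivative at which [Q'] attains its level
    would then have too large a value. *)
Lemma key_poly_val alpha Q Q' : Psi nu alpha Q -> Psi nu alpha Q' ->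
  (level nu Q < level nu Q')%E -> rval Q < rval Q'.
Proof.
move=> [[Qm Q1 Qk] sQ] [[Qm' Q1' Qk'] sQ'] lQ.
have Q0 := monic_neq0 Qm; have Q0' := monic_neq0 Qm'.
have [_ [e [_ eE _ _]]] := level_attained Q1.
have [b [e' [b0 eE' D0 DE]]] := level_attained Q1'.
move: (lQ); rewrite eE eE' lte_fin => ee'.
rewrite ltNge; apply/negP => QQ'.
have bee' : b%:R * e < b%:R * e' by rewrite ltr_pM2l// ltr0n.
have: vge Q'^`N(b) (rval Q' - b%:R * e).
  rewrite -[Q'](subrK Q) nderivnD; apply: vgeD; last first.
    rewrite subrK; apply: vgeW (level_vge b Q0 _); rewrite ?eE//.
    by rewrite lerD2r.
  have [->|h0] := eqVneq (Q' - Q) 0; first by rewrite linear0; apply: vge0.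
  have sh : (size (Q' - Q)%R < size Q)%N.
    have sQ1 : size Q = alpha.+1 by rewrite -sQ prednK// ltnW.
    have sQ1' : size Q' = alpha.+1 by rewrite -sQ' prednK// ltnW.
    by rewrite sQ1 ltnS; apply: size_sub_monic.
  have lh := ltW (Qk _ h0 sh); rewrite eE in lh.
  rewrite subrK; apply: vgeW (level_vge b h0 lh); rewrite lerD2r -vgeE//.
  by apply: vgeB; [apply: vge_rval|rewrite vgeE].
by rewrite vgeE// DE lerD2l lerN2 leNgt bee'.
Qed.

(* Compare the orders of the Hasse derivatives of a * b = u * Q + w at an order
   where the level e of Q is attained: those of a, b, w, u decrease by at most
   e0 per order, that of u * Q by exactly e. *)
Lemma level_gap Q a b e0 e : (1 < size Q)%N -> level nu Q = e%:E -> e0 < e ->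
  (forall f, f != 0 -> (size f < size Q)%N -> (level nu f <= e0%:E)%E) ->
  (size a < size Q)%N -> (size b < size Q)%N -> a != 0 -> b != 0 ->
  vge (a * b %/ Q * Q) (rval a + rval b + (e - e0)).
Proof.
move=> Q1 lQ e0e tame sa sb a0 b0.
have Q0 : Q != 0 by rewrite -size_poly_gt0 ltnW.
have ab0 : a * b != 0 by rewrite mulf_neq0.
have [t [e' [t0]]] := level_attained Q1; rewrite lQ => -[<-] D0 DE {e'}.
have tameD f i : f != 0 -> (size f < size Q)%N ->
    vge f^`N(i) (rval f - i%:R * e0).
  by move=> f0 sf; apply: level_vge => //; apply: tame.
set u := a * b %/ Q; set w := a * b %% Q.
have uw : a * b = u * Q + w by apply: divp_eq.
have [->|u0] := eqVneq u 0; first by rewrite mul0r; apply: vge0.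
have su : (size u < size Q)%N.
  rewrite size_divp//; have := size_polyMleq a b.
  move: sa sb Q1; case: (size Q) => //= s sa sb s0 sab.
  rewrite ltnS leq_subLR (leq_trans sab)// (leq_trans (leq_pred _))//.
  by rewrite leq_add.
have sw : (size w < size Q)%N by rewrite ltn_modp.
(* [M] is a common lower bound for the values of [a * b] and [w], used below for whichever is
   smaller. *)
have main (M : R) : M <= rval a + rval b -> vge w M ->
    M + (e - e0) <= rval u + rval Q.
  move=> Mab wM.
  have ab_ge : vge (a * b)^`N(t) (M - t%:R * e0).
    rewrite nderivnM; apply: vge_sum => i _.
    apply: vgeW (vgeM (tameD _ i a0 sa) (tameD _ (t - i)%N b0 sb)).
    by rewrite natrB -1?ltnS// mulrBl; move: Mab; lra.
  have w_ge : vge w^`N(t) (M - t%:R * e0).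
    have [->|w0] := eqVneq w 0; first by rewrite linear0; apply: vge0.
    by apply: vgeW (tameD _ t w0 sw); rewrite lerD2r -vgeE.
  have uQ_ge : vge (u * Q)^`N(t) (M - t%:R * e0).
    by rewrite -[u * Q](addrK w) -uw nderivnB; apply: vgeB.
  rewrite leNgt; apply/negP => lt_uQ.
  (* In the Leibniz sum every other term puts at least one derivative on [u], and each of these
     saves [e - e0]. *)
  have : vge (u * Q^`N(t))
      (Num.min (M - t%:R * e0) (rval u + rval Q - t%:R * e + (e - e0))).
    rewrite -[u * _](addrK
      (\sum_(i < t) u^`N(lift ord0 i) * Q^`N(t - lift ord0 i))).
    apply: vgeB.
      move: uQ_ge; rewrite nderivnM big_ord_recl /= nderivn0 subn0.
      by apply: vgeW; rewrite ge_min lexx.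
    apply: (vgeW (d := rval u + rval Q - t%:R * e + (e - e0))).
      by rewrite ge_min lexx orbT.
    apply: vge_sum => i _; rewrite lift0.
    have lQe : (level nu Q <= e%:E)%E by rewrite lQ.
    apply: vgeW (vgeM (tameD _ i.+1 u0 su) (level_vge (t - i.+1) Q0 lQe)).
    rewrite natrB// -natr1 !mulrBl !mulrDl !mul1r.
    have : i%:R * e0 <= i%:R * e by apply: ler_wpM2l => //; apply: ltW.
    move: (i%:R * e0) (i%:R * e) (t%:R * e) (rval u) (rval Q) => *; lra.
  rewrite vgeE ?mulf_neq0// rvalM// DE ge_min.
  have : (e - e0) * 1 <= (e - e0) * t%:R.
    by apply: ler_wpM2l; [rewrite subr_ge0 ltW|rewrite ler1n].
  rewrite mulr1 mulrBl ![_ * t%:R]mulrC.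
  have contra (v q x y : R) : v + q < M + (e - e0) -> e - e0 <= x - y ->
    (M - y <= v + (q - x)) || (v + q - x + (e - e0) <= v + (q - x)) -> False.
    by move=> H1 H2 /orP[|]; lra.
  by move=> /(contra _ _ _ _ lt_uQ).
rewrite vgeE ?mulf_neq0// rvalM//.
have [w0|w0] := eqVneq w 0.
  by apply: main => //; rewrite w0; apply: vge0.
have [wab|wab] := leP (rval a + rval b) (rval w).
  by apply: main => //; rewrite vgeE.
(* Here the carry has larger value than [w], so [a * b] has the value of [w], against [wab]. *)
have := main _ (ltW wab) (vge_rval nu_supp w0) => wuQ.
have : rval (a * b) = rval w.
  apply: (rval_dom nu_supp w0 (c := rval u + rval Q) _ _).2.
    by move: wuQ e0e; lra.
  by rewrite uw addrK; apply: vgeM; apply: vge_rval.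
by rewrite rvalM// => abw; rewrite abw ltxx in wab.
Qed.

Lemma Psi_size alpha Q : Psi nu alpha Q -> size Q = alpha.+1.
Proof. by move=> [[_ Q1 _] <-]; rewrite prednK// ltnW. Qed.

(** The gap is the difference of two levels: nonzero polynomials of degree less than [alpha] have
    level below [e0], and by [key_poly_val] those [Q] with value at least [rval Q1] have level at
    least [e1]. *)
Lemma Psi_gap_family alpha Q0 Q1 : Psi nu alpha Q0 -> Psi nu alpha Q1 ->
  (level nu Q0 < level nu Q1)%E ->
  (forall Q, Psi nu alpha Q ->
    exists2 Q', Psi nu alpha Q' & (level nu Q < level nu Q')%E) ->
  exists g, gap_family nu alpha g (fun Q => Psi nu alpha Q /\ rval Q1 <= rval Q).
Proof.
move=> P0 P1 l01 nomax.
have alpha0 : (0 < alpha)%N by have [[_ + _] _] := P0; rewrite (Psi_size P0).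
have lev Q : Psi nu alpha Q -> exists e, level nu Q = e%:E.
  by move=> [[_ /level_attained[_ [e [_ eE _ _]]] _] _]; exists e.
have [e0 e0E] := lev _ P0; have [e1 e1E] := lev _ P1.
have e01 : 0 < e1 - e0 by rewrite subr_gt0 -lte_fin -e0E -e1E.
exists (e1 - e0); split=> //.
- by move=> Q [[[]]].
- by move=> Q [/Psi_size].
- move=> Q a b c d [PQ Q1Q] sa sb ac bd.
  have [->|a0] := eqVneq a 0; first by rewrite mul0r div0p mul0r; apply: vge0.
  have [->|b0] := eqVneq b 0; first by rewrite mulr0 div0p mul0r; apply: vge0.
  have [e eE] := lev _ PQ.
  have e1e : e1 <= e.
    rewrite leNgt; apply/negP; rewrite -lte_fin -eE -e1E => lQ.
    by have := key_poly_val PQ P1 lQ; rewrite ltNge Q1Q.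
  have sQ := Psi_size PQ.
  have e0e : e0 < e by apply: lt_le_trans e1e; rewrite -subr_gt0.
  apply: vgeW (level_gap _ eE e0e _ _ _ a0 b0); rewrite ?sQ ?ltnS//.
    rewrite vgeE// in ac; rewrite vgeE// in bd.
    by apply: lerD; [apply: lerD|apply: lerB].
  move=> f f0; rewrite ltnS => sf; have [[_ _ key] _] := P0.
  by rewrite -e0E ltW// key// (Psi_size P0) ltnS.
move=> Q [PQ Q1Q]; have [Q' PQ' lQ] := nomax _ PQ.
have QQ' := key_poly_val PQ PQ' lQ.
by exists Q' => //; split=> //; apply: le_trans Q1Q (ltW QQ').
Qed.

Lemma truncation_ge Q f c : (1 < size Q)%N ->
  (c%:E <= truncation nu Q f)%E <-> tge Q f c.
Proof.
move=> Q1; rewrite /truncation; split=> [/bigmin_geP[_ fc] i|fc]; last first.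
  by apply/bigmin_geP; split=> [|i _]; [apply: leey|apply: fc].
have [fi|fi] := leqP (size f) i; last exact: (fc (Ordinal fi)).
by rewrite qcoef_ge// mul0r; apply: vge0.
Qed.

(** The cofinal part suffices: by [tge_mono_monic], a truncation on a key polynomial of smaller
    value that reached the value of [F] would force the same on [Q1]. *)
Lemma S_unstable alpha g Q1 F :
  gap_family nu alpha g (fun Q => Psi nu alpha Q /\ rval Q1 <= rval Q) ->
  Psi nu alpha Q1 ->
  S_ nu alpha F <-> unstable nu (fun Q => Psi nu alpha Q /\ rval Q1 <= rval Q) F.
Proof.
move=> PsP P1; split=> [FS|[F0 Fu] Q PQ].
  have F0 : F != 0.
    apply/eqP => F0; have := FS _ P1.
    by rewrite F0 valuation0 /truncation size_poly0 big_ord0 ltxx.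
  split=> // Q [PQ _] FQ; have := FS _ PQ.
  by rewrite ltNge rvalE// (truncation_ge _ _ _).2//; have [[]] := PQ.
rewrite ltNge rvalE//; apply/negP => /truncation_ge.
have [[Qm Qs _] _] := PQ; move=> /(_ Qs) FQ.
have [l|/ltW l] := leP (rval Q) (rval Q1).
  apply: (Fu Q1) => //.
  by apply: (tge_mono_monic nu_supp PsP Qm (Psi_size PQ)) FQ.
by apply: (Fu Q).
Qed.

End Levels.

(** * Construction of the sparse limit key polynomial *)

Local Open Scope classical_set_scope.
Local Open Scope ereal_scope.

Theorem theorem1p2 (K : fieldType) (R : realType)
    (nu : valuation {poly K} R) (p alpha : nat)
    (nu_supp : trivial_support nu)
    (nu_rank1 : rank_one nu)
    (p_exp : char_exponent nu p)
    (Psi_nonempty : Psi nu alpha !=set0)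
    (Psi_no_max : forall Q, Psi nu alpha Q ->
       exists2 Q', Psi nu alpha Q' & level nu Q < level nu Q')
    (has_limit : exists F, limit_key_poly nu alpha F) :
  exists (r : nat) (Q F : {poly K}),
    [/\ Psi nu alpha Q, limit_key_poly nu alpha F & p_expansion p r Q F].
Proof.
have [Q0 P0] := Psi_nonempty; have [Q1 P1 l01] := Psi_no_max _ P0.
have [g PsP] := Psi_gap_family nu_supp P0 P1 l01 Psi_no_max.
set Ps := (fun Q => _) in PsP.
have SE f := S_unstable nu_supp f PsP P1.
have [F [Fm /SE Fu Fmin]] := has_limit.
have {}Fmin G : unstable nu Ps G -> (size F <= size G)%N.
  by move=> /SE; apply: Fmin.
have Ps1 : exists Q, Ps Q by exists Q1.
have [B FB Fsup] := unstable_bound nu_supp PsP Ps1 Fu.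
have [Q [c [PQ Fc Bc]]] := Fsup g (gap_gt0 PsP); rewrite ltrBlDr in Bc.
have [n [n0 sF Fn FE]] := minimal_leading nu_supp PsP Fm Fu FB Fmin PQ Fc Bc.
have bin i : (0 < i)%N -> ~~ p_power p i -> _ := char_exponent_bin p_exp.
have [] := sparse_expansion nu_supp PsP PQ Fc FE Fu sF Fmin Fn FB Bc Fsup _ bin.
  by [].
rewrite /p_power /= eqn0Ngt n0 /= => /eqP nE [Q2 [d [PQ2 sd dn dP Gu]]].
set G := bigop.body _ _ _ in Gu.
have p0 : (0 < p)%N by case: p_exp => [/pcharf_prime/prime_gt0|[->]].
have Q2_1 := Ps_size_gt1 PsP PQ2.
have dQ j : (size (d j) < size Q2)%N by rewrite -(Ps_small PsP PQ2).
have sQn : size (Q2 ^+ n)%R = (n * alpha).+1 := size_Ps_exp PsP n PQ2.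
have sl : (size (\sum_(i < n) d i * Q2 ^+ i)%R < size (Q2 ^+ n)%R)%N.
  by rewrite sQn ltnS (size_sum_small PsP).
have GE : (G = \sum_(i < n) d i * Q2 ^+ i + Q2 ^+ n)%R.
  by rewrite /G big_ord_recr /= dn mul1r.
have Gm : G \is monic.
  rewrite GE monicE lead_coefDr// lead_coef_exp.
  by rewrite (eqP (gap_monic PsP PQ2)) expr1n.
have sG : size G = size F by rewrite GE addrC size_polyDl// sQn sF.
(* [G] replaces [F]: it is unstable, monic and of the same degree, hence again a limit key
   polynomial. *)
exists (logn p n), Q2, G; split; first by case: PQ2.
  by split=> // [|f /SE/Fmin]; [apply/SE|rewrite sG].
split; rewrite -?nE.
- by rewrite qcoef_uniq// ltnSn.
- by move=> i ni; rewrite qcoef_uniq// ltnS leqNgt ni.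
move=> i /andP[i0 i_n]; rewrite qcoef_uniq//.
case: ifP => [in_ di|]; last by rewrite eqxx.
have : p_power p i by apply: contraNT di => /dP ->.
rewrite /p_power /= eqn0Ngt i0 => /eqP iE; exists (logn p i) => //.
rewrite ltnNge; apply/negP => /(leq_pexp2l p0).
by rewrite -nE -iE leqNgt i_n.
Qed.
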